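(* Let $X$ be a superspace. There is a closed embedding $t:X^\circ\to X$ such that $X^\circ$ is tidy, with the following universal property: whenever $\varphi:Y\to X$ is a morphism of superspaces where $Y$ is tidy, there is a unique morphism $\varphi^\circ:Y\to X^\circ$ such that $\varphi=t\circ\varphi^\circ$.
   Context: A superspace is a pair $X=(X_0,\mathcal O_X)$ of a topological space $X_0$ and a sheaf $\mathcal O_X$ of supercommutative unital superrings whose stalks $\mathcal O_{X,x}$ are local, with maximal ideal $\mathfrak m_{X,x}$. A morphism $\varphi=(\varphi_0,\varphi^\sharp):X\to Y$ consists of a continuous map $\varphi_0:X_0\to Y_0$ and an even unital morphism $\varphi^\sharp:\varphi_0^{-1}\mathcal O_Y\to\mathcal O_X$ of sheaves of superrings with $\varphi^\sharp(\mathfrak m_{Y,\varphi_0(x)})\subseteq\mathfrak m_{X,x}$ for all $x$. A closed embedding is a morphism $\varphi:Y\to X$ such that $\varphi_0$ is a closed topological embedding and $\mathcal O_X\to\varphi_{0,*}\mathcal O_Y$ is a surjective sheaf map. A superspace $X$ is tidy if for any $x\in X_0$, any open neighbourhood $U\subseteq X_0$ of $x$ and any $f\in\mathcal O_X(U)$: if $f_y\in\mathfrak m_{X,y}^N$ for all $y\in U$ and all $N\in\mathbb N$, then $f_x=0$. *)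

(* Defs.v *)
From HB Require Import structures.
From mathcomp Require Import all_boot all_order all_algebra.
From mathcomp Require Import generic_quotient.
From mathcomp Require Import boolp classical_sets topology.
Set Implicit Arguments.
Unset Strict Implicit.
Unset Printing Implicit Defensive.
Import GRing.Theory.
Local Open Scope classical_set_scope.
Local Open Scope ring_scope.

(* [pzRingType] allows the zero ring, which is the value of every
   sheaf on the empty open set. *)

Record superring := Superring {
  sr_ring :> pzRingType;
  (* [homog false] is the even part and [homog true] the odd part *)
  homog : bool -> set sr_ring;
  homog0 : forall i, homog i 0;
  homogB : forall i a b, homog i a -> homog i b -> homog i (a - b);
  homog_dec : forall a, exists! p : sr_ring * sr_ring,
    [/\ homog false p.1, homog true p.2 & a = p.1 + p.2];
  homog1 : homog false 1;
  homogM : forall i j a b, homog i a -> homog j b -> homog (i (+) j) (a * b)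
}.

Definition supercommutative (R : superring) :=
  forall i j (a b : R), homog i a -> homog j b ->
    a * b = (-1) ^+ (i && j) * (b * a).

Definition superring_morphism (R S : superring) (f : R -> S) :=
  [/\ zmod_morphism f, monoid_morphism f &
      forall i a, homog i a -> homog i (f a)].

Definition is_ideal (R : pzRingType) (I : set R) :=
  [/\ I 0, forall a b, I a -> I b -> I (a + b) &
      forall r a, I a -> I (r * a) /\ I (a * r)].

Definition is_maximal_ideal (R : pzRingType) (M : set R) :=
  [/\ is_ideal M, M != setT &
      forall J, is_ideal J -> M `<=` J -> J = M \/ J = setT].

Definition is_local (R : pzRingType) := exists! M : set R, is_maximal_ideal M.

Definition local_ideal (R : pzRingType) (h : is_local R) : set R :=
  projT1 (cid h).

Definition ideal_mul (R : pzRingType) (I J : set R) : set R :=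
  [set c | exists (n : nat) (a b : 'I_n -> R),
     [/\ forall k, I (a k), forall k, J (b k) & c = \sum_(k < n) a k * b k]].

Fixpoint ideal_exp (R : pzRingType) (I : set R) (n : nat) : set R :=
  if n is n'.+1 then ideal_mul I (ideal_exp I n') else setT.

Record opens (X : topologicalType) := Opens {
  opens_set :> set X;
  opens_open : open opens_set
}.

Definition opens_setI (X : topologicalType) (U V : opens X) : opens X :=
  Opens (openI (opens_open U) (opens_open V)).

Definition opens_setT (X : topologicalType) : opens X := Opens (@openT X).

Lemma opens_preim_open (X Y : topologicalType) (f : X -> Y)
  (cf : continuous f) (V : opens Y) : open (f @^-1` V).
Proof. by move/continuousP: cf; apply; exact: opens_open. Qed.

Definition opens_preim (X Y : topologicalType) (f : X -> Y)
  (cf : continuous f) (V : opens Y) : opens X :=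
  Opens (opens_preim_open cf V).

Record presheaf (X : topologicalType) := Presheaf {
  sec :> opens X -> superring;
  sec_comm : forall U, supercommutative (sec U);
  res : forall U V : opens X, V `<=` U -> sec U -> sec V;
  res_morph : forall (U V : opens X) (h : V `<=` U), superring_morphism (res h);
  res_id : forall (U : opens X) (h : U `<=` U) s, res h s = s;
  res_comp : forall (U V W : opens X)
    (h : V `<=` U) (k : W `<=` V) (l : W `<=` U) s,
    res k (res h s) = res l s
}.

Arguments res_morph {X} F {U V} h : rename.

Definition sheaf_axiom (X : topologicalType) (F : presheaf X) :=
  forall (U : opens X) (I : Type) (V : I -> opens X)
    (VU : forall i, V i `<=` U) (s : forall i, F (V i)),
    U `<=` \bigcup_i V i ->
    (forall i j, res (@subIsetl _ (V i) (V j) : opens_setI _ _ `<=` _) (s i) =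
                 res (@subIsetr _ (V i) (V j) : opens_setI _ _ `<=` _) (s j)) ->
    exists! t : F U, forall i, res (VU i) t = s i.

Record sheaf (X : topologicalType) := Sheaf {
  sheaf_presheaf :> presheaf X;
  sheafP : sheaf_axiom sheaf_presheaf
}.

(* The stalk at [x]: the filtered colimit of the rings of sections over the
   open neighbourhoods of [x]. *)

Section Stalk.
Variables (X : topologicalType) (F : presheaf X) (x : X).

Record pregerm := Pregerm {
  pg_dom : opens X;
  pg_mem : opens_set pg_dom x;
  pg_sec : F pg_dom
}.
HB.instance Definition _ := gen_eqMixin pregerm.
HB.instance Definition _ := gen_choiceMixin pregerm.

Definition germ_eqv (p q : pregerm) : Prop :=
  exists (W : opens X) (hp : W `<=` pg_dom p) (hq : W `<=` pg_dom q),
    opens_set W x /\ res hp (pg_sec p) = res hq (pg_sec q).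

Lemma germ_eqv_refl p : germ_eqv p p.
Proof. by exists (pg_dom p), (@subset_refl _ _), (@subset_refl _ _); split=> //; exact: pg_mem. Qed.

Lemma germ_eqv_sym p q : germ_eqv p q -> germ_eqv q p.
Proof. by move=> [W [hp [hq [Wx e]]]]; exists W, hq, hp. Qed.

Lemma germ_eqv_trans q p r : germ_eqv p q -> germ_eqv q r -> germ_eqv p r.
Proof.
move=> [W [hp [hq [Wx e]]]] [W' [hq' [hr [Wx' e']]]].
have h1 : opens_setI W W' `<=` W := @subIsetl _ _ _.
have h2 : opens_setI W W' `<=` W' := @subIsetr _ _ _.
exists (opens_setI W W'), (subset_trans h1 hp), (subset_trans h2 hr).
split=> //.
rewrite -(res_comp hp h1) -(res_comp hr h2) e -e'.
by rewrite !(res_comp _ _ (subset_trans h1 hq)).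
Qed.

Definition germ_eqvb (p q : pregerm) : bool := `[< germ_eqv p q >].

Lemma germ_eqvb_equiv : equiv_class_of germ_eqvb.
Proof.
split=> [p|p q|q p r].
- exact/asboolP/germ_eqv_refl.
- by apply/asboolP/asboolP; exact: germ_eqv_sym.
- by move=> /asboolP pq /asboolP qr; exact/asboolP/(germ_eqv_trans pq qr).
Qed.

Canonical germ_eqv_equiv := EquivRelPack germ_eqvb_equiv.

Definition stalk : Type := {eq_quot germ_eqvb}%qT.
HB.instance Definition _ := Choice.on stalk.

Definition germ (U : opens X) (Ux : opens_set U x) (s : F U) : stalk :=
  (\pi_{eq_quot germ_eqvb} (Pregerm Ux s))%qT.

Lemma germP (U V : opens X) (Ux : opens_set U x) (Vx : opens_set V x) (s : F U) (t : F V) :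
  germ Ux s = germ Vx t <->
  exists (W : opens X) (hU : W `<=` U) (hV : W `<=` V),
    opens_set W x /\ res hU s = res hV t.
Proof.
split=> [e|e].
  by have /eqmodP/asboolP := e.
by apply/eqmodP/asboolP.
Qed.

Lemma germ_res (U V : opens X) (h : V `<=` U) (Ux : opens_set U x) (Vx : opens_set V x) (s : F U) :
  germ Vx (res h s) = germ Ux s.
Proof. by apply/germP; exists V, (@subset_refl _ _), h; rewrite res_id. Qed.

Lemma germ_surj (a : stalk) :
  exists (U : opens X) (Ux : opens_set U x) (s : F U), a = germ Ux s.
Proof.
exists (pg_dom (repr a)), (pg_mem (repr a)), (pg_sec (repr a)).
by rewrite -[LHS]reprK; congr (\pi_(_)%qT _); case: (repr a).
Qed.

Lemma germ_surj2 (a b : stalk) :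
  exists (U : opens X) (Ux : opens_set U x) (s t : F U), a = germ Ux s /\ b = germ Ux t.
Proof.
have [U [Ux [s ->]]] := germ_surj a; have [V [Vx [t ->]]] := germ_surj b.
have hU : opens_setI U V `<=` U := @subIsetl _ _ _.
have hV : opens_setI U V `<=` V := @subIsetr _ _ _.
have Wx : opens_set (opens_setI U V) x by [].
by exists _, Wx, (res hU s), (res hV t); rewrite !germ_res.
Qed.

Lemma germ_surj3 (a b c : stalk) :
  exists (U : opens X) (Ux : opens_set U x) (r s t : F U),
    [/\ a = germ Ux r, b = germ Ux s & c = germ Ux t].
Proof.
have [U [Ux [r [s [-> ->]]]]] := germ_surj2 a b.
have [V [Vx [t ->]]] := germ_surj c.
have hU : opens_setI U V `<=` U := @subIsetl _ _ _.
have hV : opens_setI U V `<=` V := @subIsetr _ _ _.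
have Wx : opens_set (opens_setI U V) x by [].
by exists _, Wx, (res hU r), (res hU s), (res hV t); rewrite !germ_res.
Qed.

Lemma resB (U V : opens X) (h : V `<=` U) : {morph @res _ F U V h : s t / s - t}.
Proof. by case: (res_morph F h). Qed.

Lemma res0 (U V : opens X) (h : V `<=` U) : @res _ F U V h 0 = 0.
Proof. by rewrite -[X in res _ X](subrr 0) resB subrr. Qed.

Lemma resN (U V : opens X) (h : V `<=` U) : {morph @res _ F U V h : s / - s}.
Proof. by move=> s; rewrite -[- s]sub0r resB res0 sub0r. Qed.

Lemma resD (U V : opens X) (h : V `<=` U) : {morph @res _ F U V h : s t / s + t}.
Proof. by move=> s t; rewrite -[t in LHS]opprK resB resN opprK. Qed.

Lemma resM (U V : opens X) (h : V `<=` U) : {morph @res _ F U V h : s t / s * t}.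
Proof. by case: (res_morph F h) => _ []. Qed.

Lemma res1 (U V : opens X) (h : V `<=` U) : @res _ F U V h 1 = 1.
Proof. by case: (res_morph F h) => _ []. Qed.

Lemma germ_repr (U : opens X) (Ux : opens_set U x) (s : F U) :
  germ_eqv (repr (germ Ux s)) (Pregerm Ux s).
Proof.
apply/asboolP.
have /eqmodP // : repr (germ Ux s) = Pregerm Ux s %[mod {eq_quot germ_eqvb}]%qT.
by rewrite reprK.
Qed.

Definition stalk_op2 (op : forall U, F U -> F U -> F U) (a b : stalk) : stalk :=
  let p := repr a in let q := repr b in
  germ (conj (pg_mem p) (pg_mem q) : opens_set (opens_setI _ _) x)
    (op _ (res (@subIsetl _ _ _ : opens_setI _ _ `<=` _) (pg_sec p))
          (res (@subIsetr _ _ _ : opens_setI _ _ `<=` _) (pg_sec q))).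

Lemma stalk_op2E (op : forall U, F U -> F U -> F U) :
  (forall (U V : opens X) (h : V `<=` U), {morph @res _ F U V h : s t / op _ s t}) ->
  forall (U : opens X) (Ux : opens_set U x) (s t : F U),
    stalk_op2 op (germ Ux s) (germ Ux t) = germ Ux (op _ s t).
Proof.
move=> opM U Ux s t; rewrite /stalk_op2.
have [W [hp [hU [Wx e]]]] := germ_repr Ux s.
have [W' [hq [hU' [Wx' e']]]] := germ_repr Ux t.
have h1 : opens_setI W W' `<=` W := @subIsetl _ _ _.
have h2 : opens_setI W W' `<=` W' := @subIsetr _ _ _.
have hI : opens_setI W W' `<=` opens_setI (pg_dom (repr (germ Ux s)))
            (pg_dom (repr (germ Ux t))).
  by move=> y [Wy W'y]; split; [exact: (hp _ Wy)|exact: (hq _ W'y)].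
apply/germP; exists (opens_setI W W'), hI, (subset_trans h1 hU); split=> //.
rewrite !opM (res_comp _ _ (subset_trans h1 hp)) -(res_comp hp h1) e.
rewrite (res_comp _ _ (subset_trans h2 hq)) -(res_comp hq h2) e'.
by rewrite !(res_comp _ _ (subset_trans h1 hU)).
Qed.

Definition stalk_add := stalk_op2 (fun U => +%R).
Definition stalk_mul := stalk_op2 (fun U => *%R).
Definition stalk_zero : stalk := @germ (opens_setT X) I 0.
Definition stalk_one : stalk := @germ (opens_setT X) I 1.
Definition stalk_opp (a : stalk) : stalk :=
  germ (pg_mem (repr a)) (- pg_sec (repr a)).

Lemma germ_addE (U : opens X) (Ux : opens_set U x) (s t : F U) :
  stalk_add (germ Ux s) (germ Ux t) = germ Ux (s + t).
Proof. by rewrite /stalk_add stalk_op2E // => V W h a b; exact: resD. Qed.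

Lemma germ_mulE (U : opens X) (Ux : opens_set U x) (s t : F U) :
  stalk_mul (germ Ux s) (germ Ux t) = germ Ux (s * t).
Proof. by rewrite /stalk_mul stalk_op2E // => V W h a b; exact: resM. Qed.

Lemma germ_zeroE (U : opens X) (Ux : opens_set U x) : stalk_zero = germ Ux 0.
Proof.
have h : U `<=` opens_setT X := @subsetT _ _.
by rewrite -(res0 h) (germ_res h I Ux).
Qed.

Lemma germ_oneE (U : opens X) (Ux : opens_set U x) : stalk_one = germ Ux 1.
Proof.
have h : U `<=` opens_setT X := @subsetT _ _.
by rewrite -(res1 h) (germ_res h I Ux).
Qed.

Lemma germ_oppE (U : opens X) (Ux : opens_set U x) (s : F U) :
  stalk_opp (germ Ux s) = germ Ux (- s).
Proof.
have [W [hp [hU [Wx e]]]] := germ_repr Ux s.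
by apply/germP; exists W, hp, hU; split; rewrite // !resN e.
Qed.

Lemma stalk_addA : associative stalk_add.
Proof.
by move=> a b c; have [U [Ux [r [s [t [-> -> ->]]]]]] := germ_surj3 a b c;
  rewrite !germ_addE addrA.
Qed.

Lemma stalk_addC : commutative stalk_add.
Proof.
by move=> a b; have [U [Ux [r [s [-> ->]]]]] := germ_surj2 a b;
  rewrite !germ_addE addrC.
Qed.

Lemma stalk_add0 : left_id stalk_zero stalk_add.
Proof.
by move=> a; have [U [Ux [r ->]]] := germ_surj a; rewrite (germ_zeroE Ux) germ_addE add0r.
Qed.

Lemma stalk_addN : left_inverse stalk_zero stalk_opp stalk_add.
Proof.
by move=> a; have [U [Ux [r ->]]] := germ_surj a;
  rewrite germ_oppE germ_addE addNr (germ_zeroE Ux).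
Qed.

HB.instance Definition _ :=
  GRing.isZmodule.Build stalk stalk_addA stalk_addC stalk_add0 stalk_addN.

Lemma stalk_mulA : associative stalk_mul.
Proof.
by move=> a b c; have [U [Ux [r [s [t [-> -> ->]]]]]] := germ_surj3 a b c;
  rewrite !germ_mulE mulrA.
Qed.

Lemma stalk_mul1l : left_id stalk_one stalk_mul.
Proof.
by move=> a; have [U [Ux [r ->]]] := germ_surj a; rewrite (germ_oneE Ux) germ_mulE mul1r.
Qed.

Lemma stalk_mul1r : right_id stalk_one stalk_mul.
Proof.
by move=> a; have [U [Ux [r ->]]] := germ_surj a; rewrite (germ_oneE Ux) germ_mulE mulr1.
Qed.

Lemma stalk_mulDl : left_distributive stalk_mul +%R.
Proof.
by move=> a b c; have [U [Ux [r [s [t [-> -> ->]]]]]] := germ_surj3 a b c;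
  rewrite /+%R /= !(germ_mulE, germ_addE) mulrDl.
Qed.

Lemma stalk_mulDr : right_distributive stalk_mul +%R.
Proof.
by move=> a b c; have [U [Ux [r [s [t [-> -> ->]]]]]] := germ_surj3 a b c;
  rewrite /+%R /= !(germ_mulE, germ_addE) mulrDr.
Qed.

HB.instance Definition _ := GRing.Zmodule_isPzRing.Build stalk
  stalk_mulA stalk_mul1l stalk_mul1r stalk_mulDl stalk_mulDr.

Lemma germB (U : opens X) (Ux : opens_set U x) : zmod_morphism (germ Ux).
Proof.
move=> s t; rewrite -germ_addE -germ_oppE; reflexivity.
Qed.

Lemma germ_monoid (U : opens X) (Ux : opens_set U x) : monoid_morphism (germ Ux).
Proof.
split; first by rewrite -(germ_oneE Ux).
by move=> s t; rewrite -germ_mulE.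
Qed.

End Stalk.

Record superspace := Superspace {
  ss_top :> topologicalType;
  struct_sheaf : sheaf ss_top;
  ss_local : forall x : ss_top, is_local (stalk struct_sheaf x)
}.

Definition max_ideal (X : superspace) (x : X) : set (stalk (struct_sheaf X) x) :=
  local_ideal (ss_local x).

(* The sheaf map f_0^{-1} O_Y -> O_X is given in its adjoint form
   O_Y -> f_{0,*} O_X, i.e. by maps O_Y(V) -> O_X(f_0^{-1} V) natural in V. *)
Record morphism (X Y : superspace) := Morphism {
  mor_fun :> X -> Y;
  mor_cont : continuous mor_fun;
  pullback : forall V : opens Y,
    struct_sheaf Y V -> struct_sheaf X (opens_preim mor_cont V);
  pullback_morph : forall V, superring_morphism (@pullback V);
  pullback_res : forall (V W : opens Y) (h : W `<=` V)
    (h' : opens_preim mor_cont W `<=` opens_preim mor_cont V) s,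
    pullback (res h s) = res h' (pullback s);
  pullback_local : forall (x : X) (V : opens Y) (Vx : opens_set V (mor_fun x))
    (s : struct_sheaf Y V),
    max_ideal (germ Vx s) ->
    max_ideal (germ (Vx : opens_set (opens_preim mor_cont V) x) (pullback s))
}.

Arguments mor_cont {X Y} f : rename.
Arguments pullback {X Y} f {V} s : rename.
Arguments pullback_morph {X Y} f V : rename.
Arguments pullback_local {X Y} f {x V} Vx {s} _ : rename.

Section Comp.
Variables (X Y Z : superspace) (g : morphism Y Z) (f : morphism X Y).

Lemma comp_cont : continuous (g \o f).
Proof. by move=> x; apply: continuous_comp; exact: mor_cont. Qed.

(* The two sides have the same underlying set, so restriction along this
   inclusion is a mere identification. *)
Lemma comp_preim (V : opens Z) : opens_preim comp_cont V `<=`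
  opens_preim (mor_cont f) (opens_preim (mor_cont g) V).
Proof. by []. Qed.

Definition comp_pullback (V : opens Z) (s : struct_sheaf Z V) :
    struct_sheaf X (opens_preim comp_cont V) :=
  res (@comp_preim V) (pullback f (pullback g s)).

Lemma comp_pullback_morph V : superring_morphism (@comp_pullback V).
Proof.
have [gB [g1 gM] gh] := pullback_morph g V.
have [fB [f1 fM] fh] := pullback_morph f (opens_preim (mor_cont g) V).
have [rB [r1 rM] rh] :=
  res_morph (struct_sheaf X) (@comp_preim V).
rewrite /comp_pullback; split=> [s t||i a ha].
- by rewrite gB fB rB.
- by split=> [|s t]; rewrite ?g1 ?f1 ?r1 // gM fM rM.
- exact/rh/fh/gh.
Qed.

Lemma comp_pullback_res (V W : opens Z) (h : W `<=` V)
  (h' : opens_preim comp_cont W `<=` opens_preim comp_cont V) s :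
  comp_pullback (res h s) = res h' (comp_pullback s).
Proof.
rewrite /comp_pullback.
have h1 : opens_preim (mor_cont g) W `<=`
  opens_preim (mor_cont g) V by move=> y; exact: h.
have h2 : opens_preim (mor_cont f) (opens_preim (mor_cont g) W)
  `<=` opens_preim (mor_cont f) (opens_preim (mor_cont g) V)
  by move=> y; exact: h.
rewrite (pullback_res h h1) (pullback_res h1 h2).
by rewrite !(res_comp _ _ (subset_trans h' (@comp_preim V))).
Qed.

Lemma comp_pullback_local (x : X) (V : opens Z) (Vx : opens_set V ((g \o f) x))
    (s : struct_sheaf Z V) :
  max_ideal (germ Vx s) ->
  max_ideal (germ (Vx : opens_set (opens_preim comp_cont V) x) (comp_pullback s)).
Proof.
move=> ms; rewrite /comp_pullback.
rewrite (germ_res _ (Vx : opens_set (opens_preim (mor_cont f)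
  (opens_preim (mor_cont g) V)) x)).
apply: (pullback_local f (Vx : opens_set (opens_preim (mor_cont g) V) (f x))).
exact: (pullback_local g (Vx : opens_set V (g (f x)))).
Qed.

Definition mor_comp : morphism X Z :=
  Morphism comp_pullback_morph comp_pullback_res comp_pullback_local.

End Comp.

(* A topological embedding is an injective map whose source carries the
   topology induced from the target; it is closed when its image is. *)
Definition closed_top_embedding (X Y : topologicalType) (f : X -> Y) :=
  [/\ injective f,
      forall U : set X, open U <-> exists2 V : set Y, open V & U = f @^-1` V &
      closed (range f)].

(* Surjectivity of O_Y -> f_{0,*} O_X as a map of sheaves: sections of the
   target lift locally on Y. *)
Definition pullback_surjective (X Y : superspace) (f : morphism X Y) :=
  forall (V : opens Y) (s : struct_sheaf X (opens_preim (mor_cont f) V))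
    (y : Y), opens_set V y ->
  exists (W : opens Y) (h : opens_preim (mor_cont f) W `<=`
                            opens_preim (mor_cont f) V)
    (t : struct_sheaf Y W),
    [/\ opens_set W y, W `<=` V & pullback f t = res h s].

Definition closed_embedding (X Y : superspace) (f : morphism X Y) :=
  closed_top_embedding f /\ pullback_surjective f.

Definition tidy (X : superspace) :=
  forall (x : X) (U : opens X) (Ux : opens_set U x) (f : struct_sheaf X U),
    (forall (y : X) (Uy : opens_set U y) (N : nat),
       ideal_exp (@max_ideal X y) N (germ Uy f)) ->
    germ Ux f = 0.

(* Main.v *)
Require Import Defs.
From HB Require Import structures.
From mathcomp Require Import all_boot all_algebra.
From mathcomp Require Import generic_quotient.
From mathcomp Require Import boolp classical_sets topology.
Set Implicit Arguments.
Unset Strict Implicit.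
Unset Printing Implicit Defensive.
Import GRing.Theory.
Local Open Scope classical_set_scope.
Local Open Scope ring_scope.

(** Call a germ flat when it lies in every power of the maximal ideal of its
    stalk.  A morphism of superspaces is local, so it maps flat germs to flat
    germs; if its source is tidy, every section of the target with only flat
    germs is therefore killed.  Hence the tidying keeps the space of [X] and
    divides the structure sheaf by the sections all of whose germs are flat.
    The quotient is realised as the image of the structure sheaf in the product
    of the rings stalk modulo flat germs ([quot_sheaf]).

    Three points carry the argument.  First, the flat germs form a homogeneous
    ideal ([ideal_infpow_odd]), so that the quotient is again a sheaf of
    superrings.  The maximal ideal itself need not be homogeneous when 2 is not
    invertible.  But parity is an automorphism and preserves the unique maximal
    ideal [m], and the projection to the odd part is a derivation twisted by
    parity; it therefore maps the power [m^(n+1)] into [m^n], and preserves the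
    intersection of all powers.

    Second, the stalks of the quotient are images of the old stalks under maps
    whose kernels consist of flat germs ([stalk_pi_surj], [stalk_pi_ker]).
    Since these kernels lie in every power of [m], the new stalks are local
    ([image_is_local]) and an element lies in [m^n] as soon as its image lies in
    the n-th power of the new maximal ideal ([tidying_ideal_exp]).  This makes
    the quotient tidy.

    Third, a morphism from a tidy space has a unique factorisation: sections of
    the quotient lift locally, the pullbacks of two lifts agree because they
    differ by a section with flat germs ([tidy_pullback_eq]), and the
    pullbacks of local lifts glue ([descent_exists]). *)

(** * Ring homomorphisms and two-sided ideals *)

Definition ring_hom (R S : pzRingType) (f : R -> S) :=
  zmod_morphism f /\ monoid_morphism f.

Section RingHom.
Variables (R S : pzRingType) (f : R -> S).
Hypothesis hf : ring_hom f.

Lemma ring_homB : {morph f : a b / a - b}. Proof. by case: hf. Qed.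
Lemma ring_homM : {morph f : a b / a * b}. Proof. by case: hf => _ []. Qed.
Lemma ring_hom1 : f 1 = 1. Proof. by case: hf => _ []. Qed.
Lemma ring_hom0 : f 0 = 0.
Proof. by rewrite -[X in f X](subrr 0) ring_homB subrr. Qed.
Lemma ring_homN : {morph f : a / - a}.
Proof. by move=> a; rewrite -[- a]sub0r ring_homB ring_hom0 sub0r. Qed.
Lemma ring_homD : {morph f : a b / a + b}.
Proof. by move=> a b; rewrite -[b in LHS]opprK ring_homB ring_homN opprK. Qed.
Lemma ring_homX n : {morph f : a / a ^+ n}.
Proof.
move=> a; elim: n => [|n IH]; first by rewrite !expr0 ring_hom1.
by rewrite !exprS ring_homM IH.
Qed.
Lemma ring_hom_sign n : f ((-1) ^+ n) = (-1) ^+ n.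
Proof. by rewrite ring_homX ring_homN ring_hom1. Qed.

End RingHom.

Section Ideals.
Variable R : pzRingType.
Implicit Types I J K M : set R.

Lemma is_ideal0 I : is_ideal I -> I 0. Proof. by case. Qed.
Lemma is_idealD I a b : is_ideal I -> I a -> I b -> I (a + b).
Proof. by case=> _ + _; exact. Qed.
Lemma is_idealMl I r a : is_ideal I -> I a -> I (r * a).
Proof. by case=> _ _ h /(h r) []. Qed.
Lemma is_idealMr I r a : is_ideal I -> I a -> I (a * r).
Proof. by case=> _ _ h /(h r) []. Qed.
Lemma is_idealN I a : is_ideal I -> I a -> I (- a).
Proof. by move=> hI Ia; rewrite -mulN1r; exact: is_idealMl. Qed.
Lemma is_ideal_subl I a b : is_ideal I -> I (a - b) -> I b -> I a.
Proof. by move=> hI Iab Ib; rewrite -(subrK b a); exact: is_idealD. Qed.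

Lemma ideal_eqT I : is_ideal I -> I 1 -> I = setT.
Proof.
move=> hI I1; apply/seteqP; split=> // a _.
by rewrite -[a]mulr1; exact: is_idealMl.
Qed.

Lemma ideal_setT : is_ideal (@setT R). Proof. by []. Qed.

Lemma ideal_mul_mem I J a b : I a -> J b -> ideal_mul I J (a * b).
Proof.
move=> Ia Jb; exists 1%N, (fun=> a), (fun=> b); split=> //.
by rewrite big_ord1.
Qed.

Lemma ideal_mulD I J a b :
  ideal_mul I J a -> ideal_mul I J b -> ideal_mul I J (a + b).
Proof.
move=> [n [u [v [Iu Jv ->]]]] [n' [u' [v' [Iu' Jv' ->]]]].
exists (n + n')%N.
exists (fun k => match fintype.split k with inl i => u i | inr j => u' j end).
exists (fun k => match fintype.split k with inl i => v i | inr j => v' j end).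
split=> [k|k|]; try by case: fintype.split.
rewrite big_split_ord /=; congr (_ + _); apply: eq_bigr => i _.
  by rewrite (unsplitK (inl i)).
by rewrite (unsplitK (inr i)).
Qed.

Lemma ideal_mul_ind I J (P : R -> Prop) :
    P 0 -> (forall a b, P a -> P b -> P (a + b)) ->
    (forall a b, I a -> J b -> P (a * b)) ->
  forall c, ideal_mul I J c -> P c.
Proof.
move=> P0 PD PM c [n [u [v [Iu Jv ->]]]].
by apply: big_ind => // i _; exact: PM.
Qed.

Lemma ideal_mul_ideal I J :
  is_ideal I -> is_ideal J -> is_ideal (ideal_mul I J).
Proof.
move=> hI hJ.
have z : ideal_mul I J 0.
  by rewrite -(mulr0 0); apply: ideal_mul_mem; exact: is_ideal0.
split=> // [a b|r a ha]; first exact: ideal_mulD.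
split; move: a ha; apply: ideal_mul_ind; rewrite ?mulr0 ?mul0r //.
- by move=> a b; rewrite mulrDr; exact: ideal_mulD.
- move=> a b Ia Jb; rewrite mulrA.
  by apply: ideal_mul_mem => //; exact: is_idealMl.
- by move=> a b; rewrite mulrDl; exact: ideal_mulD.
- move=> a b Ia Jb; rewrite -mulrA.
  by apply: ideal_mul_mem => //; exact: is_idealMr.
Qed.

Lemma ideal_exp_ideal I n : is_ideal I -> is_ideal (ideal_exp I n).
Proof.
by move=> hI; elim: n => [|n IH] /=; [exact: ideal_setT|exact: ideal_mul_ideal].
Qed.

Lemma ideal_exp1 I : is_ideal I -> ideal_exp I 1 `<=` I.
Proof.
move=> hI; apply: ideal_mul_ind => [|a b|a b Ia _]; first exact: is_ideal0.
  exact: is_idealD.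
exact: is_idealMr.
Qed.

(** For the maximal ideal of a stalk, these are the germs that vanish to
    infinite order. *)
Definition ideal_infpow I : set R := [set a | forall n, ideal_exp I n a].

Lemma ideal_infpow_ideal I : is_ideal I -> is_ideal (ideal_infpow I).
Proof.
move=> hI; have hn n := ideal_exp_ideal n hI.
split=> [n|a b ha hb n|r a ha]; first exact: is_ideal0 (hn n).
  exact: is_idealD (hn n) (ha n) (hb n).
by split=> n; [exact: is_idealMl (hn n) (ha n)|exact: is_idealMr (hn n) (ha n)].
Qed.

Lemma ideal_infpow_sub I : is_ideal I -> ideal_infpow I `<=` I.
Proof. by move=> hI a /(_ 1%N); exact: ideal_exp1. Qed.

Lemma local_ideal_max (h : is_local R) : is_maximal_ideal (local_ideal h).
Proof. by rewrite /local_ideal; case: cid => M []. Qed.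

Lemma local_ideal_uniq (h : is_local R) M :
  is_maximal_ideal M -> M = local_ideal h.
Proof. by rewrite /local_ideal; case: cid => K [_ u] /= /u. Qed.

Lemma local_ideal_ideal (h : is_local R) : is_ideal (local_ideal h).
Proof. by case: (local_ideal_max h). Qed.

Lemma local_ideal_neq1 (h : is_local R) : ~ local_ideal h 1.
Proof.
by move=> h1; case: (local_ideal_max h) => hi /eqP + _; apply; exact: ideal_eqT.
Qed.

End Ideals.

Lemma ideal_exp_hom (R S : pzRingType) (f : R -> S) (I : set R) (J : set S) n :
    ring_hom f -> is_ideal J -> (forall a, I a -> J (f a)) ->
  forall a, ideal_exp I n a -> ideal_exp J n (f a).
Proof.
move=> hf hJ IJ; elim: n => [//|n IH] /=.
have hJn := ideal_exp_ideal n.+1 hJ.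
apply: ideal_mul_ind => [|a b|a b Ia Ib].
- by rewrite (ring_hom0 hf); exact: is_ideal0 hJn.
- by rewrite (ring_homD hf); exact: is_idealD hJn.
- by rewrite (ring_homM hf); apply: ideal_mul_mem; [exact: IJ|exact: IH].
Qed.

Section SurjectiveHom.
Variables (R S : pzRingType) (f : R -> S).
Hypothesis hf : ring_hom f.
Hypothesis fsurj : forall b, exists a, b = f a.

Lemma ideal_preim (J : set S) : is_ideal J -> is_ideal (f @^-1` J).
Proof.
move=> hJ; split=> [|a b|r a] /=.
- by rewrite (ring_hom0 hf); exact: is_ideal0.
- by rewrite (ring_homD hf); exact: is_idealD.
- by rewrite !(ring_homM hf) => Ja;
  split; [exact: is_idealMl|exact: is_idealMr].
Qed.

Lemma ideal_image (I : set R) : is_ideal I -> is_ideal (f @` I).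
Proof.
move=> hI; split.
- by exists 0; [exact: is_ideal0|exact: ring_hom0].
- move=> _ _ [a Ia <-] [b Ib <-].
  by exists (a + b); [exact: is_idealD|exact: ring_homD].
- move=> r _ [a Ia <-]; have [c ->] := fsurj r; split.
    by exists (c * a); [exact: is_idealMl|exact: ring_homM].
  by exists (a * c); [exact: is_idealMr|exact: ring_homM].
Qed.

(** An ideal that contains the preimage of [M] contains the kernel, hence is
    recovered from its image. *)
Lemma maximal_ideal_preim (M : set S) :
  is_maximal_ideal M -> is_maximal_ideal (f @^-1` M).
Proof.
case=> hM /eqP MT maxM; split; first exact: ideal_preim.
  apply/eqP => e; apply: MT; apply: ideal_eqT => //.
  have : (f @^-1` M) 1 by rewrite e.
  by rewrite /preimage /= (ring_hom1 hf).
move=> J hJ MJ.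
have kerJ a : f a = 0 -> J a.
  by move=> fa; apply: MJ; rewrite /preimage /= fa; exact: is_ideal0.
have MfJ : M `<=` f @` J.
  move=> b Mb; have [a eb] := fsurj b; exists a => //; apply: MJ.
  by rewrite /preimage /= -eb.
case: (maxM _ (ideal_image hJ) MfJ) => e; [left|right].
  apply/seteqP; split=> // a Ja; rewrite /preimage /= -e; exact: imageP.
apply: ideal_eqT => //.
have [c Jc fc] : (f @` J) 1 by rewrite e.
apply: (is_ideal_subl (b := c)) => //; apply: kerJ.
by rewrite (ring_homB hf) fc (ring_hom1 hf) subrr.
Qed.

Section LocalSource.
Variable hR : is_local R.
Hypothesis kerf : forall a, f a = 0 -> local_ideal hR a.
Let m := local_ideal hR.
Let hm : is_ideal m := local_ideal_ideal hR.

Lemma image_local_ideal_maximal : is_maximal_ideal (f @` m).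
Proof.
split; first exact: ideal_image.
  apply/eqP => e; have [a ma fa] : (f @` m) 1 by rewrite e.
  apply: (@local_ideal_neq1 _ hR); apply: (is_ideal_subl (b := a)) => //.
  by apply: kerf; rewrite (ring_homB hf) fa (ring_hom1 hf) subrr.
move=> K hK mK; case: (local_ideal_max hR) => _ _ maxm.
have mfK : m `<=` f @^-1` K by move=> a ma; apply: mK; exact: imageP.
case: (maxm _ (ideal_preim hK) mfK) => e; [left|right].
  apply/seteqP; split=> // b Kb; have [a eb] := fsurj b.
  by exists a => //; rewrite /m -e /preimage /= -eb.
apply: ideal_eqT => //; rewrite -(ring_hom1 hf).
by have : (f @^-1` K) 1 by rewrite e.
Qed.

(** The kernel hypothesis keeps the image of the maximal ideal proper.  Every
    maximal ideal of the target pulls back to the one of the source, hence is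
    its image. *)
Lemma image_is_local : is_local S.
Proof.
exists (f @` m); split=> [|M maxM]; first exact: image_local_ideal_maximal.
rewrite /m -(local_ideal_uniq hR (maximal_ideal_preim maxM)).
apply/seteqP; split=> [_ [a Ma <-]//|b Mb].
by have [a eb] := fsurj b; exists a => //; rewrite /preimage /= -eb.
Qed.

Lemma local_ideal_image (hS : is_local S) : local_ideal hS = f @` m.
Proof. by rewrite -(local_ideal_uniq hS image_local_ideal_maximal). Qed.

Lemma local_ideal_homE (hS : is_local S) a :
  local_ideal hS (f a) <-> local_ideal hR a.
Proof.
rewrite local_ideal_image; split=> [[b mb e]|ma]; last exact: imageP.
apply: (is_ideal_subl (b := b)) => //; apply: kerf.
by rewrite (ring_homB hf) e subrr.
Qed.

Lemma ideal_exp_image (hS : is_local S) n c :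
  ideal_exp (local_ideal hS) n c -> exists2 a, ideal_exp m n a & f a = c.
Proof.
elim: n c => [c _|n IH]; first by have [a ->] := fsurj c; exists a.
apply: ideal_mul_ind => [|_ _ [a ha <-] [b hb <-]|a b].
- exists 0; last exact: ring_hom0.
  by apply: is_ideal0; exact: (ideal_exp_ideal n.+1).
- exists (a + b); last exact: ring_homD.
  by apply: is_idealD => //; exact: (ideal_exp_ideal n.+1).
move=> + /IH [v mv <-]; rewrite local_ideal_image => -[u mu <-].
by exists (u * v); [exact: ideal_mul_mem|exact: ring_homM].
Qed.

End LocalSource.
End SurjectiveHom.

(** * Superrings as rings with an odd projection *)

Definition parity (R : pzRingType) (od : R -> R) (a : R) := a - od a *+ 2.

(** A superring structure is the same datum as the projection onto the odd
    part.  This projection is a derivation twisted by the parity automorphism,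
    and in this form the axioms are equations, which pass to stalks, quotients
    and products. *)
Record odd_projection (R : pzRingType) (od : R -> R) := OddProjection {
  odp_B : zmod_morphism od;
  odp_idem : forall a, od (od a) = od a;
  odp_1 : od 1 = 0;
  odp_M : forall a b, od (a * b) = od a * b + parity od a * od b
}.

Definition parity_part (R : pzRingType) (od : R -> R) (i : bool) (a : R) :=
  if i then od a else a - od a.

Definition parity_commutative (R : pzRingType) (od : R -> R) :=
  forall i j a b, parity_part od i a * parity_part od j b =
    (-1) ^+ (i && j) * (parity_part od j b * parity_part od i a).

Lemma parity_part_hom (R S : pzRingType) (odR : R -> R) (odS : S -> S)
    (f : R -> S) : ring_hom f -> (forall a, f (odR a) = odS (f a)) ->
  forall i a, f (parity_part odR i a) = parity_part odS i (f a).
Proof. by move=> hf fod [] a /=; rewrite ?(ring_homB hf) fod. Qed.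

Section OddProjection.
Variables (R : pzRingType) (od : R -> R).
Hypothesis hod : odd_projection od.

Lemma odp_0 : od 0 = 0.
Proof. by rewrite -[X in od X](subrr 0) (odp_B hod) subrr. Qed.
Lemma odp_N a : od (- a) = - od a.
Proof. by rewrite -[- a]sub0r (odp_B hod) odp_0 sub0r. Qed.
Lemma odp_D a b : od (a + b) = od a + od b.
Proof. by rewrite -[b in LHS]opprK (odp_B hod) odp_N opprK. Qed.

Let hom (i : bool) : set R := [set a | od a = if i then a else 0].

Lemma odd_hom0 i : hom i 0.
Proof. by rewrite /hom /= odp_0; case: i. Qed.

Lemma odd_homB i a b : hom i a -> hom i b -> hom i (a - b).
Proof.
by rewrite /hom /= (odp_B hod) => -> ->; case: i => //; rewrite subrr.
Qed.

Lemma odd_hom_dec a : exists! p : R * R,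
  [/\ hom false p.1, hom true p.2 & a = p.1 + p.2].
Proof.
exists (a - od a, od a); split=> /=.
  by rewrite /hom /= (odp_B hod) (odp_idem hod) subrr subrK.
move=> [b c] [/= hb hc ->].
by rewrite odp_D hb hc add0r addrK.
Qed.

Lemma odd_hom1 : hom false 1. Proof. exact: odp_1. Qed.

Lemma odd_homM i j a b : hom i a -> hom j b -> hom (i (+) j) (a * b).
Proof.
rewrite /hom /= (odp_M hod) /parity => -> ->.
case: i; case: j => /=; rewrite ?mul0rn ?subr0 ?mul0r ?mulr0 ?add0r ?addr0 //.
by rewrite mulr2n opprD addrA subrr sub0r mulNr subrr.
Qed.

Definition superring_of_odd : superring :=
  Superring odd_hom0 odd_homB odd_hom_dec odd_hom1 odd_homM.

Lemma superring_of_odd_comm :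
  parity_commutative od -> supercommutative superring_of_odd.
Proof.
move=> pc i j a b ha hb.
have pe k c : hom k c -> parity_part od k c = c.
  by rewrite /hom /=; case: k => /= ->; rewrite ?subr0.
by rewrite -{1 2}(pe _ _ ha) -{1 2}(pe _ _ hb) pc.
Qed.

Lemma parity_ring_hom : ring_hom (parity od).
Proof.
split=> [a b|].
  rewrite /parity (odp_B hod) mulrnBl !opprB addrACA [RHS]addrACA.
  by congr (_ + _); rewrite addrC.
split=> [|a b]; first by rewrite /parity (odp_1 hod) mul0rn subr0.
rewrite /parity (odp_M hod) mulrnDl opprD addrA -mulrnAl -mulrBl.
by rewrite -mulrnAr -mulrBr.
Qed.

Lemma parityK a : parity od (parity od a) = a.
Proof.
have e : od (parity od a) = - od a.
  rewrite /parity (odp_B hod) mulr2n odp_D (odp_idem hod) opprD addrA subrr.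
  by rewrite sub0r.
by rewrite {1}/parity e mulNrn opprK subrK.
Qed.

(** The maximal ideal of a local ring is stable under every automorphism, in
    particular under parity; so the twisted Leibniz rule shows that the odd
    projection lowers the order of vanishing by at most one.  This replaces
    the homogeneity of the maximal ideal, which can fail where 2 is not
    invertible. *)
Lemma ideal_exp_odd (h : is_local R) n a :
  ideal_exp (local_ideal h) n.+1 a -> ideal_exp (local_ideal h) n (od a).
Proof.
have psurj b : exists c, b = parity od c.
  by exists (parity od b); rewrite parityK.
have pm b : local_ideal h b -> local_ideal h (parity od b).
  have := maximal_ideal_preim parity_ring_hom psurj (local_ideal_max h).
  by move=> /(local_ideal_uniq h) {1}<-.
have hm := local_ideal_ideal h.
elim: n a => [//|n IH] a.
have hn := ideal_exp_ideal n.+1 hm.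
move: a; apply: ideal_mul_ind => [|a b|a b ma mb].
- by rewrite odp_0; exact: is_ideal0 hn.
- by rewrite odp_D; exact: is_idealD hn.
rewrite (odp_M hod); apply: (is_idealD hn); first exact: (is_idealMl _ hn).
by apply: ideal_mul_mem; [exact: pm|exact: IH].
Qed.

Lemma ideal_infpow_odd (h : is_local R) a :
  ideal_infpow (local_ideal h) a -> ideal_infpow (local_ideal h) (od a).
Proof. by move=> ha n; exact: ideal_exp_odd (ha n.+1). Qed.

End OddProjection.

Section OddPart.
Variable R : superring.
Implicit Types a b c : R.

Definition odd_part a : R := (projT1 (cid (homog_dec a))).2.

Lemma odd_part_spec a : homog false (a - odd_part a) /\ homog true (odd_part a).
Proof.
rewrite /odd_part; case: cid => -[b c] [[/= hb hc e] _] /=; split=> //.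
by rewrite e addrK.
Qed.

Lemma odd_part_uniq b c : homog false b -> homog true c -> odd_part (b + c) = c.
Proof.
move=> hb hc; rewrite /odd_part; case: cid => p [_ u] /=.
by rewrite (u (b, c)).
Qed.

Lemma homogD i a b : homog i a -> homog i b -> homog i (a + b).
Proof.
move=> ha hb; rewrite -[b]opprK; apply: homogB => //.
by rewrite -sub0r; apply: homogB => //; exact: homog0.
Qed.

Lemma homogE i a : homog i a <-> odd_part a = if i then a else 0.
Proof.
split=> [ha|].
  have h0 k := @homog0 R k.
  case: i ha => ha; first by rewrite -{1}[a]add0r odd_part_uniq.
  by rewrite -{1}[a]addr0 odd_part_uniq.
have [he ho] := odd_part_spec a.
by case: i => e; [rewrite -e|rewrite -[a]subr0 -e].
Qed.

Lemma odd_part_projection : odd_projection odd_part.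
Proof.
have dec a : exists b c, [/\ homog false b, homog true c & a = b + c].
  have [he ho] := odd_part_spec a.
  by exists (a - odd_part a), (odd_part a); split; rewrite ?subrK.
split=> [a b|a||a b].
- have [a0 [a1 [ha0 ha1 ->]]] := dec a; have [b0 [b1 [hb0 hb1 ->]]] := dec b.
  by rewrite opprD addrACA !odd_part_uniq //; exact: homogB.
- by apply/(homogE true); case: (odd_part_spec a).
- by apply/(homogE false); exact: homog1.
- have [a0 [a1 [ha0 ha1 ->]]] := dec a; have [b0 [b1 [hb0 hb1 ->]]] := dec b.
  rewrite (odd_part_uniq ha0) // (odd_part_uniq hb0) //.
  have -> : (a0 + a1) * (b0 + b1) = (a0 * b0 + a1 * b1) + (a0 * b1 + a1 * b0).
    by rewrite mulrDl !mulrDr [a1 * b0 + _]addrC addrACA.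
  rewrite odd_part_uniq.
  + rewrite /parity odd_part_uniq // mulr2n opprD addrA addrK mulrBl mulrDr.
    by rewrite addrACA subrr addr0 addrC.
  + by apply: homogD; [exact: (homogM ha0 hb0)|exact: (homogM ha1 hb1)].
  + by apply: homogD; [exact: (homogM ha0 hb1)|exact: (homogM ha1 hb0)].
Qed.

Lemma odd_part_parity_commutative :
  supercommutative R -> parity_commutative odd_part.
Proof.
move=> sc i j a b; apply: sc; [case: i|case: j] => /=;
  by case: (odd_part_spec a); case: (odd_part_spec b).
Qed.

End OddPart.

Lemma superring_morphismP (R S : superring) (f : R -> S) :
  superring_morphism f <->
  ring_hom f /\ forall a, f (odd_part a) = odd_part (f a).
Proof.
split=> [[fB fM fh]|[hf fod]].
  split=> // a; have [he ho] := odd_part_spec a.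
  have hf : ring_hom f by [].
  rewrite -{2}(subrK (odd_part a) a) (ring_homD hf) odd_part_uniq //;
    exact: fh.
case: (hf) => fB fM; split=> // i a /homogE e; apply/homogE.
by rewrite -fod e; case: (i) => //; exact: ring_hom0.
Qed.

(** * Quotient rings *)

Section QuotientRing.
Variables (R : pzRingType) (I : set R) (hI : is_ideal I).

Definition ideal_eqv (a b : R) : bool := `[< I (a - b) >].

Lemma ideal_eqv_equiv : equiv_class_of ideal_eqv.
Proof.
have dec a b : ideal_eqv a b <-> I (a - b) by split=> /asboolP.
have sym a b : ideal_eqv a b -> ideal_eqv b a.
  by move=> /dec h; apply/dec; rewrite -opprB; exact: is_idealN.
split=> [a|a b|b a c].
- by apply/dec; rewrite subrr; exact: is_ideal0.
- by apply/idP/idP; exact: sym.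
- move=> /dec hab /dec hbc; apply/dec.
  by rewrite -(subrK b a) -addrA; exact: is_idealD.
Qed.

Canonical ideal_eqv_rel := EquivRelPack ideal_eqv_equiv.

Definition quot_ring : Type := {eq_quot ideal_eqv}%qT.
HB.instance Definition _ := Choice.on quot_ring.

Definition quot_pi (a : R) : quot_ring := (\pi_{eq_quot ideal_eqv} a)%qT.

Lemma quot_piE a b : quot_pi a = quot_pi b <-> I (a - b).
Proof.
split=> [e|e]; first by have /eqmodP/asboolP := e.
by apply/eqmodP/asboolP.
Qed.

Lemma quot_pi_surj (q : quot_ring) : exists a, q = quot_pi a.
Proof. by exists (repr q); rewrite /quot_pi reprK. Qed.

Lemma quot_pi_repr a : I (repr (quot_pi a) - a).
Proof. by apply/quot_piE; rewrite /quot_pi reprK. Qed.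

Definition quot_zero := quot_pi 0.
Definition quot_one := quot_pi 1.
Definition quot_opp (q : quot_ring) := quot_pi (- repr q).
Definition quot_add (q r : quot_ring) := quot_pi (repr q + repr r).
Definition quot_mul (q r : quot_ring) := quot_pi (repr q * repr r).

Lemma quot_oppE a : quot_opp (quot_pi a) = quot_pi (- a).
Proof.
by apply/quot_piE; rewrite -opprD; apply: is_idealN => //; exact: quot_pi_repr.
Qed.

Lemma quot_addE a b : quot_add (quot_pi a) (quot_pi b) = quot_pi (a + b).
Proof.
apply/quot_piE; rewrite opprD addrACA.
by apply: is_idealD => //; exact: quot_pi_repr.
Qed.

Lemma quot_mulE a b : quot_mul (quot_pi a) (quot_pi b) = quot_pi (a * b).
Proof.
apply/quot_piE; set a' := repr _; set b' := repr _.
have -> : a' * b' - a * b = (a' - a) * b' + a * (b' - b).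
  by rewrite mulrBl mulrBr addrA subrK.
apply: (is_idealD hI); first exact: (is_idealMr _ hI (quot_pi_repr a)).
exact: (is_idealMl _ hI (quot_pi_repr b)).
Qed.

Ltac quot_rep q := let a := fresh "a" in have [a ->] := quot_pi_surj q.

Lemma quot_addA : associative quot_add.
Proof.
move=> p q r; quot_rep p; quot_rep q; quot_rep r.
by rewrite !quot_addE addrA.
Qed.
Lemma quot_addC : commutative quot_add.
Proof. by move=> p q; quot_rep p; quot_rep q; rewrite !quot_addE addrC. Qed.
Lemma quot_add0 : left_id quot_zero quot_add.
Proof. by move=> p; quot_rep p; rewrite quot_addE add0r. Qed.
Lemma quot_addN : left_inverse quot_zero quot_opp quot_add.
Proof. by move=> p; quot_rep p; rewrite quot_oppE quot_addE addNr. Qed.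

HB.instance Definition _ :=
  GRing.isZmodule.Build quot_ring quot_addA quot_addC quot_add0 quot_addN.

Lemma quot_mulA : associative quot_mul.
Proof.
move=> p q r; quot_rep p; quot_rep q; quot_rep r.
by rewrite !quot_mulE mulrA.
Qed.
Lemma quot_mul1l : left_id quot_one quot_mul.
Proof. by move=> p; quot_rep p; rewrite quot_mulE mul1r. Qed.
Lemma quot_mul1r : right_id quot_one quot_mul.
Proof. by move=> p; quot_rep p; rewrite quot_mulE mulr1. Qed.
Lemma quot_mulDl : left_distributive quot_mul +%R.
Proof.
move=> p q r; quot_rep p; quot_rep q; quot_rep r.
by rewrite /+%R /= !(quot_mulE, quot_addE) mulrDl.
Qed.
Lemma quot_mulDr : right_distributive quot_mul +%R.
Proof.
move=> p q r; quot_rep p; quot_rep q; quot_rep r.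
by rewrite /+%R /= !(quot_mulE, quot_addE) mulrDr.
Qed.

HB.instance Definition _ := GRing.Zmodule_isPzRing.Build quot_ring
  quot_mulA quot_mul1l quot_mul1r quot_mulDl quot_mulDr.

Lemma quot_pi_hom : ring_hom quot_pi.
Proof.
split=> [a b|]; first by rewrite -quot_addE -quot_oppE.
by split=> // a b; rewrite -quot_mulE.
Qed.

Section QuotientOdd.
Variables (od : R -> R) (hod : odd_projection od).
Hypothesis odI : forall a, I a -> I (od a).

Definition quot_odd (q : quot_ring) : quot_ring := quot_pi (od (repr q)).

Lemma quot_oddE a : quot_odd (quot_pi a) = quot_pi (od a).
Proof.
by apply/quot_piE; rewrite -(odp_B hod); apply: odI; exact: quot_pi_repr.
Qed.

Lemma quot_odd_projection : odd_projection quot_odd.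
Proof.
have hB := ring_homB quot_pi_hom; have hM := ring_homM quot_pi_hom.
have hD := ring_homD quot_pi_hom.
split=> [p q|p||p q].
- by quot_rep p; quot_rep q; rewrite -hB !quot_oddE (odp_B hod) hB.
- by quot_rep p; rewrite !quot_oddE (odp_idem hod).
- by rewrite -(ring_hom1 quot_pi_hom) quot_oddE (odp_1 hod).
- quot_rep p; quot_rep q.
  rewrite /parity -hM !quot_oddE (odp_M hod).
  by rewrite /parity !mulr2n hD !hM hB hD.
Qed.

Lemma quot_odd_comm : parity_commutative od -> parity_commutative quot_odd.
Proof.
move=> pc i j p q; quot_rep p; quot_rep q.
have e k c := parity_part_hom quot_pi_hom (fun a => esym (quot_oddE a)) k c.
rewrite -!e -!(ring_homM quot_pi_hom) pc.
by rewrite !(ring_homM quot_pi_hom) (ring_hom_sign quot_pi_hom).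
Qed.

End QuotientOdd.
End QuotientRing.

(** * Stalks *)

Lemma germ_hom (X : topologicalType) (F : presheaf X) (x : X) (U : opens X)
  (Ux : opens_set U x) : ring_hom (@germ X F x U Ux).
Proof. by split; [exact: germB|exact: germ_monoid]. Qed.

Lemma germ_irr (X : topologicalType) (F : presheaf X) (x : X) (U : opens X)
  (Ux Ux' : opens_set U x) (s : F U) : germ Ux s = germ Ux' s.
Proof. by congr (germ _ _); exact: Prop_irrelevance. Qed.

(** Naturality is relative to an operation [T] on open sets, so that the same
    construction serves endomorphisms of a presheaf ([T] the identity) and
    pullbacks along a continuous map ([T] the inverse image). *)
Section StalkMap.
Variables (X Y : topologicalType) (F : presheaf Y) (G : presheaf X).
Variables (y : Y) (x : X) (T : opens Y -> opens X).
Hypothesis Tmem : forall V : opens Y, opens_set V y -> opens_set (T V) x.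
Hypothesis Tsub : forall V W : opens Y, W `<=` V -> T W `<=` T V.
Variable k : forall V : opens Y, F V -> G (T V).
Hypothesis kres : forall (V W : opens Y) (h : W `<=` V) (h' : T W `<=` T V) s,
  k (res h s) = res h' (k s).

Definition stalk_map (a : stalk F y) : stalk G x :=
  germ (Tmem (pg_mem (repr a))) (k (pg_sec (repr a))).

Lemma stalk_mapE (V : opens Y) (Vy : opens_set V y) (s : F V) :
  stalk_map (germ Vy s) = germ (Tmem Vy) (k s).
Proof.
have [W [hp [hV [Wy e]]]] := germ_repr Vy s.
apply/germP; exists (T W), (Tsub hp), (Tsub hV); split; first exact: Tmem.
by rewrite -!kres e.
Qed.

Lemma stalk_map_hom : (forall V, ring_hom (@k V)) -> ring_hom stalk_map.
Proof.
move=> hk; split=> [a b|].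
  have [U [Uy [s [t [-> ->]]]]] := germ_surj2 a b.
  by rewrite -germB !stalk_mapE (ring_homB (hk U)) germB.
split=> [|a b].
  have h := stalk_mapE (V := opens_setT Y) I 1.
  rewrite (ring_hom1 (hk _)) !(ring_hom1 (germ_hom _ _)) in h.
  exact: h.
have [U [Uy [s [t [-> ->]]]]] := germ_surj2 a b.
by rewrite -(ring_homM (germ_hom F Uy)) !stalk_mapE (ring_homM (hk U))
  (ring_homM (germ_hom _ _)).
Qed.

End StalkMap.

Lemma res_hom (X : topologicalType) (F : presheaf X) (U V : opens X)
  (h : V `<=` U) : ring_hom (res h : F U -> F V).
Proof. by have /superring_morphismP[] := res_morph F h. Qed.

Lemma res_odd (X : topologicalType) (F : presheaf X) (U V : opens X)
  (h : V `<=` U) (s : F U) : res h (odd_part s) = odd_part (res h s).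
Proof. by have /superring_morphismP[] := res_morph F h. Qed.

Section StalkOdd.
Variables (X : topologicalType) (F : presheaf X) (x : X).

Definition stalk_odd : stalk F x -> stalk F x :=
  stalk_map (T := id) (fun V Vx => Vx) (fun V => @odd_part (F V)).

Lemma stalk_oddE (U : opens X) (Ux : opens_set U x) (s : F U) :
  stalk_odd (germ Ux s) = germ Ux (odd_part s).
Proof.
by rewrite /stalk_odd stalk_mapE // => V W h h' t; rewrite -res_odd;
  congr (res _ _); exact: Prop_irrelevance.
Qed.

Lemma stalk_odd_projection : odd_projection stalk_odd.
Proof.
have hB U Ux := ring_homB (germ_hom (x := x) F (U := U) Ux).
have hM U Ux := ring_homM (germ_hom (x := x) F (U := U) Ux).
have hD U Ux := ring_homD (germ_hom (x := x) F (U := U) Ux).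
have hp U := odd_part_projection (F U).
split=> [a b|a||a b].
- have [U [Ux [s [t [-> ->]]]]] := germ_surj2 a b.
  by rewrite -hB !stalk_oddE (odp_B (hp U)) hB.
- by have [U [Ux [s ->]]] := germ_surj a; rewrite !stalk_oddE (odp_idem (hp U)).
- have T1 := ring_hom1 (germ_hom (x := x) F (U := opens_setT X) I).
  by rewrite -T1 stalk_oddE (odp_1 (hp _)) (ring_hom0 (germ_hom F _)).
- have [U [Ux [s [t [-> ->]]]]] := germ_surj2 a b.
  rewrite /parity -hM !stalk_oddE (odp_M (hp U)).
  by rewrite /parity !mulr2n hD !hM hB hD.
Qed.

Lemma stalk_odd_comm : parity_commutative stalk_odd.
Proof.
move=> i j a b; have [U [Ux [s [t [-> ->]]]]] := germ_surj2 a b.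
have hg := germ_hom F Ux.
have e k c := parity_part_hom hg (fun a => esym (stalk_oddE Ux a)) k c.
rewrite -!e -!(ring_homM hg).
rewrite (odd_part_parity_commutative (@sec_comm X F U)).
by rewrite !(ring_homM hg) (ring_hom_sign hg).
Qed.

End StalkOdd.

Lemma section_eq (X : topologicalType) (F : sheaf X) (U : opens X) (s t : F U) :
  (forall x (Ux : opens_set U x), germ Ux s = germ Ux t) -> s = t.
Proof.
move=> est.
have loc (i : {x | opens_set U x}) : exists W : {W : opens X | W `<=` U},
    opens_set (sval W) (sval i) /\
    res (proj2_sig W) s = res (proj2_sig W) t.
  case: i => x Ux /=; have /germP[W [h [h' [Wx e]]]] := est x Ux.
  exists (exist _ W h); split=> //=; rewrite e.
  by congr (res _ _); exact: Prop_irrelevance.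
pose V i := sval (cid (loc i)).
have VP i : opens_set (sval (V i)) (sval i) /\
  res (proj2_sig (V i)) s = res (proj2_sig (V i)) t := proj2_sig (cid (loc i)).
have [||r [_ ur]] := @sheafP X F U _ (fun i => sval (V i))
    (fun i => proj2_sig (V i)) (fun i => res (proj2_sig (V i)) s).
- by move=> x Ux; exists (exist _ x Ux) => //; exact: (VP (exist _ x Ux)).1.
- move=> i j; have h : opens_setI (sval (V i)) (sval (V j)) `<=` U.
    by move=> x [+ _]; exact: (proj2_sig (V i)).
  by rewrite !(res_comp _ _ h).
by rewrite -(ur s) // -(ur t) // => i; rewrite (VP i).2.
Qed.

(** * The quotient of a sheaf by ideals of its stalks *)

Lemma superring_of_odd_odd (R : pzRingType) (od : R -> R)
  (h : odd_projection od) (a : superring_of_odd h) : odd_part a = od a.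
Proof.
rewrite -{1}(subrK (od a) a); apply: odd_part_uniq => /=.
  by rewrite (odp_B h) (odp_idem h) subrr.
exact: odp_idem.
Qed.

(** For a family of ideals [I x] of the stalks, the sheaf below is the image of
    [F] in the product of the rings [stalk F x / I x]: its sections are the
    families that lift to [F] locally.  Two sections of [F] have the same image
    when their difference has all its germs in [I], so this is the quotient of
    [F] by the sections with all germs in [I], sheafified without a colimit. *)
Section QuotientSheaf.
Variables (X : topologicalType) (F : sheaf X).
Variable I : forall x, set (stalk F x).
Arguments I : clear implicits.
Hypothesis hI : forall x, is_ideal (I x).
Hypothesis oddI : forall x a, I x a -> I x (stalk_odd a).

Definition fiber x : pzRingType := quot_ring (hI x).
Definition germ_pi x (U : opens X) (Ux : opens_set U x) (s : F U) : fiber x :=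
  quot_pi (hI x) (germ Ux s).

Definition liftable (U : opens X) (s : forall x, opens_set U x -> fiber x) :=
  forall x, opens_set U x -> exists (W : opens X) (h : W `<=` U) (t : F W),
    opens_set W x /\
    forall y (Wy : opens_set W y), s y (h y Wy) = germ_pi Wy t.

Record quot_section (U : opens X) := QuotSection {
  qval :> forall x, opens_set U x -> fiber x;
  qval_lift : liftable qval
}.

HB.instance Definition _ U := gen_eqMixin (quot_section U).
HB.instance Definition _ U := gen_choiceMixin (quot_section U).

Lemma quot_section_eq U (s t : quot_section U) :
  (forall x Ux, s x Ux = t x Ux) -> s = t.
Proof.
case: s t => [s hs] [t ht] /= e.
have st : s = t by apply: functional_extensionality_dep => x;
  apply: functional_extensionality_dep => Ux; exact: e.
by case: _ / st in ht e *; congr QuotSection; exact: Prop_irrelevance.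
Qed.

Lemma qval_irr U (s : quot_section U) x Ux Ux' : s x Ux = s x Ux'.
Proof. by congr (qval s _); exact: Prop_irrelevance. Qed.

Lemma liftable2 (opF : forall U, F U -> F U -> F U)
    (opQ : forall x, fiber x -> fiber x -> fiber x) :
    (forall x U (Ux : opens_set U x) (s t : F U),
       opQ x (germ_pi Ux s) (germ_pi Ux t) = germ_pi Ux (opF U s t)) ->
  forall U (s t : quot_section U),
    liftable (fun x Ux => opQ x (s x Ux) (t x Ux)).
Proof.
move=> op U s t x Ux.
have [W [h [u [Wx su]]]] := qval_lift s Ux.
have [W' [h' [v [Wx' tv]]]] := qval_lift t Ux.
have h1 : opens_setI W W' `<=` W by move=> y [].
have h2 : opens_setI W W' `<=` W' by move=> y [].
exists (opens_setI W W'), (subset_trans h1 h), (opF _ (res h1 u) (res h2 v)).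
split=> // y Wy; rewrite -op (qval_irr s _ (h y (h1 y Wy))) su.
rewrite (qval_irr t _ (h' y (h2 y Wy))) tv /germ_pi.
by rewrite (germ_res h1 (h1 y Wy) Wy) (germ_res h2 (h2 y Wy) Wy).
Qed.

Definition quot_section_map2 opF opQ op U (s t : quot_section U) :=
  QuotSection (@liftable2 opF opQ op U s t).

Lemma germ_pi_hom x U (Ux : opens_set U x) : ring_hom (@germ_pi x U Ux).
Proof.
have hg := germ_hom F Ux; have hp := quot_pi_hom (hI x).
split=> [s t|]; first by rewrite /germ_pi (ring_homB hg) (ring_homB hp).
split=> [|s t]; first by rewrite /germ_pi (ring_hom1 hg) (ring_hom1 hp).
by rewrite /germ_pi (ring_homM hg) (ring_homM hp).
Qed.

Definition fiber_odd x : fiber x -> fiber x := quot_odd (@stalk_odd _ F x).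

Lemma fiber_odd_projection x : odd_projection (@fiber_odd x).
Proof. exact: quot_odd_projection (stalk_odd_projection F x) (@oddI x). Qed.

Lemma germ_pi_odd x U (Ux : opens_set U x) s :
  fiber_odd (germ_pi Ux s) = germ_pi Ux (odd_part s).
Proof.
rewrite /fiber_odd /germ_pi quot_oddE ?stalk_oddE //; last exact: oddI.
exact: stalk_odd_projection.
Qed.

Definition quot_section_add := @quot_section_map2 (fun U => +%R) (fun x => +%R)
  (fun x U Ux s t => esym (ring_homD (germ_pi_hom Ux) s t)).

Definition quot_section_mul := @quot_section_map2 (fun U => *%R) (fun x => *%R)
  (fun x U Ux s t => esym (ring_homM (germ_pi_hom Ux) s t)).

Definition quot_section_opp U (s : quot_section U) :=
  @quot_section_map2 (fun U a b => - a) (fun x a b => - a)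
    (fun x U Ux s t => esym (ring_homN (germ_pi_hom Ux) s)) U s s.

Definition quot_section_odd U (s : quot_section U) :=
  @quot_section_map2 (fun U a b => odd_part a) (fun x a b => fiber_odd a)
    (fun x U Ux s t => germ_pi_odd Ux s) U s s.

Lemma quot_section_of_liftable (U V : opens X) (h : V `<=` U) (s : F U) :
  liftable (fun x (Vx : opens_set V x) => germ_pi (h x Vx) s).
Proof.
move=> x Vx; exists V, (@subset_refl _ V), (res h s); split=> // y Vy.
by rewrite /germ_pi (germ_res h (h y Vy) Vy);
  congr (quot_pi _ _); exact: germ_irr.
Qed.

(** The restriction to [V] is built in: inverse images under the identity map
    are equal to the given open set only up to proofs of openness. *)
Definition quot_section_of (U V : opens X) (h : V `<=` U) (s : F U) :=
  QuotSection (quot_section_of_liftable h s).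

Definition quot_section_const U (c : F U) :=
  quot_section_of (@subset_refl _ U) c.

Lemma quot_section_addA U : associative (@quot_section_add U).
Proof. by move=> a b c; apply: quot_section_eq => x Ux /=; rewrite addrA. Qed.
Lemma quot_section_addC U : commutative (@quot_section_add U).
Proof. by move=> a b; apply: quot_section_eq => x Ux /=; rewrite addrC. Qed.
Lemma quot_section_add0 U :
  left_id (quot_section_const 0) (@quot_section_add U).
Proof.
move=> a; apply: quot_section_eq => x Ux /=.
by rewrite (ring_hom0 (germ_pi_hom _)) add0r.
Qed.
Lemma quot_section_addN U : left_inverse (quot_section_const 0)
  (@quot_section_opp U) (@quot_section_add U).
Proof.
move=> a; apply: quot_section_eq => x Ux /=.
by rewrite (ring_hom0 (germ_pi_hom _)) addNr.
Qed.

HB.instance Definition _ U := GRing.isZmodule.Build (quot_section U)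
  (@quot_section_addA U) (@quot_section_addC U)
  (@quot_section_add0 U) (@quot_section_addN U).

Lemma quot_section_mulA U : associative (@quot_section_mul U).
Proof. by move=> a b c; apply: quot_section_eq => x Ux /=; rewrite mulrA. Qed.
Lemma quot_section_mul1l U :
  left_id (quot_section_const 1) (@quot_section_mul U).
Proof.
move=> a; apply: quot_section_eq => x Ux /=.
by rewrite (ring_hom1 (germ_pi_hom _)) mul1r.
Qed.
Lemma quot_section_mul1r U :
  right_id (quot_section_const 1) (@quot_section_mul U).
Proof.
move=> a; apply: quot_section_eq => x Ux /=.
by rewrite (ring_hom1 (germ_pi_hom _)) mulr1.
Qed.
Lemma quot_section_mulDl U : left_distributive (@quot_section_mul U) +%R.
Proof. by move=> a b c; apply: quot_section_eq => x Ux /=; rewrite mulrDl. Qed.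
Lemma quot_section_mulDr U : right_distributive (@quot_section_mul U) +%R.
Proof. by move=> a b c; apply: quot_section_eq => x Ux /=; rewrite mulrDr. Qed.

HB.instance Definition _ U := GRing.Zmodule_isPzRing.Build (quot_section U)
  (@quot_section_mulA U) (@quot_section_mul1l U) (@quot_section_mul1r U)
  (@quot_section_mulDl U) (@quot_section_mulDr U).

Lemma qval_hom U x (Ux : opens_set U x) :
  ring_hom (fun s : quot_section U => s x Ux).
Proof.
split=> //; split=> //=.
by rewrite (ring_hom1 (germ_pi_hom _)).
Qed.

Lemma qval_odd U x (Ux : opens_set U x) (s : quot_section U) :
  quot_section_odd s x Ux = fiber_odd (s x Ux).
Proof. by []. Qed.

Lemma quot_section_odd_projection U : odd_projection (@quot_section_odd U).
Proof.
have v x Ux := @qval_hom U x Ux.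
split=> [s t|s||s t]; apply: quot_section_eq => x Ux.
- by rewrite (ring_homB (v x Ux)) !qval_odd (ring_homB (v x Ux))
    (odp_B (@fiber_odd_projection x)).
- by rewrite !qval_odd (odp_idem (@fiber_odd_projection x)).
- rewrite qval_odd (ring_hom1 (v x Ux)) (ring_hom0 (v x Ux)).
  exact: (odp_1 (@fiber_odd_projection x)).
- rewrite qval_odd (ring_homM (v x Ux)) (odp_M (@fiber_odd_projection x)).
  rewrite /parity !mulr2n.
  by rewrite (ring_homD (v x Ux)) !(ring_homM (v x Ux)) (ring_homB (v x Ux))
    (ring_homD (v x Ux)).
Qed.

Lemma quot_section_comm U : parity_commutative (@quot_section_odd U).
Proof.
move=> i j s t; apply: quot_section_eq => x Ux.
have hv := qval_hom Ux.
have e := parity_part_hom hv (qval_odd Ux).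
rewrite !(ring_homM hv) (ring_hom_sign hv) !e.
exact: (quot_odd_comm (stalk_odd_projection F x) (@oddI x)
          (@stalk_odd_comm _ F x)).
Qed.

Definition quot_superring U : superring :=
  superring_of_odd (quot_section_odd_projection U).

Lemma quot_section_res_liftable (U V : opens X) (h : V `<=` U)
  (s : quot_section U) : liftable (fun x (Vx : opens_set V x) => s x (h x Vx)).
Proof.
move=> x Vx; have [W [k [t [Wx e]]]] := qval_lift s (h x Vx).
have h1 : opens_setI V W `<=` W by move=> y [].
have h2 : opens_setI V W `<=` V by move=> y [].
exists (opens_setI V W), h2, (res h1 t); split=> // y Wy.
rewrite /germ_pi (germ_res h1 (h1 y Wy) Wy) -[quot_pi _ _]e.
exact: qval_irr.
Qed.

Definition quot_res (U V : opens X) (h : V `<=` U)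
  (s : quot_superring U) : quot_superring V :=
  QuotSection (quot_section_res_liftable h s).

Lemma quot_res_morph (U V : opens X) (h : V `<=` U) :
  superring_morphism (quot_res h).
Proof.
apply/superring_morphismP; split.
  split; [|split]; first by move=> s t; exact: quot_section_eq.
    apply: quot_section_eq => x Vx.
    by rewrite (ring_hom1 (qval_hom Vx)) [LHS](ring_hom1 (qval_hom (h x Vx))).
  by move=> s t; exact: quot_section_eq.
by move=> s; rewrite !superring_of_odd_odd; exact: quot_section_eq.
Qed.

Lemma quot_res_id (U : opens X) (h : U `<=` U) s : quot_res h s = s.
Proof. by apply: quot_section_eq => x Ux; exact: (qval_irr s). Qed.

Lemma quot_res_comp (U V W : opens X) (h : V `<=` U) (k : W `<=` V)
  (l : W `<=` U) s : quot_res k (quot_res h s) = quot_res l s.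
Proof. by apply: quot_section_eq => x Ux; exact: (qval_irr s). Qed.

Definition quot_presheaf : presheaf X :=
  Presheaf (fun U => superring_of_odd_comm (@quot_section_comm U))
    quot_res_morph quot_res_id quot_res_comp.

Lemma quot_sheaf_axiom : sheaf_axiom quot_presheaf.
Proof.
move=> U J V VU s cov compat.
have agree i j x (xi : opens_set (V i) x) (xj : opens_set (V j) x) :
    s i x xi = s j x xj.
  have := congr1 (fun u : quot_section (opens_setI (V i) (V j)) =>
    u x (conj xi xj)) (compat i j).
  rewrite /= (qval_irr (s i) _ xi) => ->; exact: (qval_irr (s j)).
have idx x (Ux : opens_set U x) : exists i, opens_set (V i) x.
  by have [i _ ?] := cov x Ux; exists i.
pose t x (Ux : opens_set U x) : fiber x :=
  s (sval (cid (idx x Ux))) x (proj2_sig (cid (idx x Ux))).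
have tE x Ux i (xi : opens_set (V i) x) : t x Ux = s i x xi by exact: agree.
have tl : liftable t.
  move=> x Ux; have [i _ xi] := cov x Ux.
  have [W [h [u [Wx e]]]] := qval_lift (s i) xi.
  exists W, (subset_trans h (VU i)), u; split=> // y Wy.
  by rewrite (tE _ _ i (h y Wy)) e.
exists (QuotSection tl : quot_presheaf U); split=> [i|t' ht'].
  by apply: quot_section_eq => x xi; exact: tE.
apply: quot_section_eq => x Ux; have [i _ xi] := cov x Ux.
rewrite /= (tE x Ux i xi) -(ht' i); exact: (qval_irr t').
Qed.

Definition quot_sheaf : sheaf X := Sheaf quot_sheaf_axiom.

(** Equality in the quotient is tested on germs; this is what identifies the
    kernel of [F -> quot_sheaf]. *)
Lemma quot_section_of_eq (U U' V : opens X) (h : V `<=` U) (h' : V `<=` U')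
    (s : F U) (s' : F U') :
  (quot_section_of h s : quot_sheaf V) = quot_section_of h' s' <->
  forall x (Vx : opens_set V x), I x (germ (h x Vx) s - germ (h' x Vx) s').
Proof.
split=> [e x Vx|e]; last by apply: quot_section_eq => x Vx; apply/quot_piE.
apply/quot_piE.
exact: (congr1 (fun u : quot_section V => u x Vx) e).
Qed.

Lemma quot_section_of_res (U V W : opens X) (h : V `<=` U) (k : W `<=` V)
    (l : W `<=` U) (s : F U) :
  res k (quot_section_of h s : quot_sheaf V) = quot_section_of l s.
Proof.
by apply: quot_section_eq => x Wx; congr (quot_pi _ _); exact: germ_irr.
Qed.

Lemma quot_section_res_of (U V W : opens X) (h : V `<=` U) (k : W `<=` V)
    (l : W `<=` U) (s : F U) :
  (quot_section_of k (res h s) : quot_sheaf W) = quot_section_of l s.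
Proof.
by apply/quot_section_of_eq => x Wx; rewrite (germ_res h (l x Wx)) subrr;
  exact: is_ideal0.
Qed.

Lemma quot_section_lift (U : opens X) (s : quot_sheaf U) x :
    opens_set U x -> exists (W : opens X) (h : W `<=` U) (t : F W),
  opens_set W x /\ res h s = quot_section_of (@subset_refl _ W) t.
Proof.
move=> Ux; have [W [h [t [Wx e]]]] := qval_lift s Ux.
exists W, h, t; split=> //; apply: quot_section_eq => y Wy /=.
rewrite e; congr (quot_pi _ _); exact: germ_irr.
Qed.

Lemma quot_section_of_morph (U V : opens X) (h : V `<=` U) :
  superring_morphism (quot_section_of h : F U -> quot_sheaf V).
Proof.
apply/superring_morphismP; split.
  split; [|split]; first move=> s t; last move=> s t;
    apply: quot_section_eq => x Vx.
  - by rewrite (ring_homB (qval_hom Vx)) /= (ring_homB (germ_pi_hom _)).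
  - by rewrite (ring_hom1 (qval_hom Vx)) /= (ring_hom1 (germ_pi_hom _)).
  - by rewrite (ring_homM (qval_hom Vx)) /= (ring_homM (germ_pi_hom _)).
move=> s; rewrite superring_of_odd_odd; apply: quot_section_eq => x Vx.
by rewrite qval_odd /= germ_pi_odd.
Qed.

Definition stalk_pi x : stalk F x -> stalk quot_sheaf x :=
  stalk_map (T := id) (fun V Vx => Vx)
    (fun V => quot_section_of (@subset_refl _ V) : F V -> quot_sheaf V).

Lemma stalk_piE x (U : opens X) (Ux : opens_set U x) (s : F U) :
  stalk_pi (germ Ux s) =
  germ Ux (quot_section_of (@subset_refl _ U) s : quot_sheaf U).
Proof.
rewrite /stalk_pi stalk_mapE // => V W h h' t.
by rewrite (quot_section_of_res _ _ h) (quot_section_res_of _ _ h).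
Qed.

Lemma stalk_pi_hom x : ring_hom (@stalk_pi x).
Proof.
apply: stalk_map_hom => [//|V W h h' t|V].
  by rewrite (quot_section_of_res _ _ h) (quot_section_res_of _ _ h).
by have /superring_morphismP[] := quot_section_of_morph (@subset_refl _ V).
Qed.

Lemma stalk_pi_surj x (b : stalk quot_sheaf x) : exists a, b = stalk_pi a.
Proof.
have [U [Ux [s ->]]] := germ_surj b.
have [W [h [t [Wx e]]]] := quot_section_lift s Ux.
by exists (germ Wx t); rewrite stalk_piE -e (germ_res h Ux).
Qed.

(** A germ dies in the quotient only if [I] contains the germs of a
    representative at every point of a neighbourhood, the base point among
    them. *)
Lemma stalk_pi_ker x (a : stalk F x) : stalk_pi a = 0 -> I x a.
Proof.
have [U [Ux [s ->]]] := germ_surj a.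
rewrite -(ring_hom0 (stalk_pi_hom x)) -(ring_hom0 (germ_hom F Ux)) !stalk_piE.
move=> /germP[W [h [h' [Wx]]]].
rewrite !(quot_section_of_res _ _ h) => /quot_section_of_eq/(_ x Wx).
rewrite (ring_hom0 (germ_hom F _)) subr0.
by rewrite (germ_irr _ Ux).
Qed.

End QuotientSheaf.

(** * Morphisms of superspaces on germs *)

Lemma pullback_hom (X Y : superspace) (f : morphism X Y) (V : opens Y) :
  ring_hom (@pullback _ _ f V).
Proof. by have /superring_morphismP[] := pullback_morph f V. Qed.

Lemma pullback_odd (X Y : superspace) (f : morphism X Y) (V : opens Y)
  (s : struct_sheaf Y V) : pullback f (odd_part s) = odd_part (pullback f s).
Proof. by have /superring_morphismP[] := pullback_morph f V. Qed.

Lemma germ_pullback_res (X Y : superspace) (f : morphism X Y) (V W : opens Y)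
    (h : W `<=` V) (s : struct_sheaf Y V) (x : X)
    (Wx : opens_set (opens_preim (mor_cont f) W) x)
    (Vx : opens_set (opens_preim (mor_cont f) V) x) :
  germ Wx (pullback f (res h s)) = germ Vx (pullback f s).
Proof.
have h' : opens_preim (mor_cont f) W `<=` opens_preim (mor_cont f) V.
  by move=> z; exact: h.
by rewrite (pullback_res (m := f) h h') (germ_res h' Vx).
Qed.

(** Two pullbacks of a section live over inverse images that are only
    propositionally equal, whereas their germs at a point have the same type. *)
Lemma morphism_ext (X Y : superspace) (f g : morphism X Y) :
    (forall x, f x = g x) ->
    (forall (V : opens Y) (s : struct_sheaf Y V) (x : X)
       (fx : opens_set (opens_preim (mor_cont f) V) x)
       (gx : opens_set (opens_preim (mor_cont g) V) x),
       germ fx (pullback f s) = germ gx (pullback g s)) ->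
  f = g.
Proof.
case: f g => [f cf pf mf rf lf] [g cg pg mg rg lg] /= /funext fg.
case: _ / fg in cg pg mg rg lg *.
case: _ / (Prop_irrelevance cf cg) in pg mg rg lg * => e.
have pfg : pf = pg.
  apply: functional_extensionality_dep => V; apply: funext => s.
  by apply: section_eq => x Vx; exact: e.
case: _ / pfg in mg rg lg *.
by congr Morphism; exact: Prop_irrelevance.
Qed.

Lemma germ_pullback_congr (X Y : superspace) (f g : morphism X Y) (V : opens Y)
    (s : struct_sheaf Y V) (x : X)
    (fx : opens_set (opens_preim (mor_cont f) V) x)
    (gx : opens_set (opens_preim (mor_cont g) V) x) :
  f = g -> germ fx (pullback f s) = germ gx (pullback g s).
Proof. by move=> fg; case: _ / fg in gx *; exact: germ_irr. Qed.

Lemma germ_mor_comp (X Y Z : superspace) (g : morphism Y Z) (f : morphism X Y)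
    (V : opens Z) (s : struct_sheaf Z V) (x : X)
    (Vx : opens_set (opens_preim (mor_cont (mor_comp g f)) V) x)
    (Vx' : opens_set (opens_preim (mor_cont f)
       (opens_preim (mor_cont g) V)) x) :
  germ Vx (pullback (mor_comp g f) s) = germ Vx' (pullback f (pullback g s)).
Proof. exact: germ_res. Qed.

Lemma max_ideal_ideal (X : superspace) (x : X) : is_ideal (@max_ideal X x).
Proof. exact: local_ideal_ideal. Qed.

Lemma pullback_ideal_exp (X Y : superspace) (f : morphism X Y) (V : opens Y)
    (s : struct_sheaf Y V) (x : X) (Vx : opens_set V (f x)) n :
  ideal_exp (@max_ideal Y (f x)) n (germ Vx s) ->
  ideal_exp (@max_ideal X x) n
    (germ (Vx : opens_set (opens_preim (mor_cont f) V) x) (pullback f s)).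
Proof.
pose T := opens_preim (mor_cont f).
have Tsub (U W : opens Y) : W `<=` U -> T W `<=` T U by move=> h z; exact: h.
pose fx := @stalk_map X Y (struct_sheaf Y) (struct_sheaf X) (f x) x T
  (fun V Vx => Vx) (@pullback _ _ f).
have fxE := stalk_mapE (y := f x) (x := x) (T := T) (fun V Vx => Vx) Tsub
  (@pullback_res _ _ f).
rewrite -[germ _ (pullback f s)]fxE; apply: ideal_exp_hom.
- apply: stalk_map_hom => //; first exact: pullback_res.
  exact: pullback_hom.
- exact: max_ideal_ideal.
- move=> a; have [U [Ux [t ->]]] := germ_surj a; rewrite fxE.
  exact: pullback_local.
Qed.

(** * The tidying of a superspace *)

Section Tidying.
Variable X : superspace.

Definition flat_ideal (x : X) : set (stalk (struct_sheaf X) x) :=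
  ideal_infpow (@max_ideal X x).
Arguments flat_ideal : clear implicits.

Lemma flat_ideal_ideal x : is_ideal (flat_ideal x).
Proof. exact/ideal_infpow_ideal/max_ideal_ideal. Qed.

Lemma flat_ideal_odd x a : flat_ideal x a -> flat_ideal x (stalk_odd a).
Proof. exact: (ideal_infpow_odd (stalk_odd_projection _ x)). Qed.

Definition tidying_sheaf : sheaf X :=
  quot_sheaf flat_ideal_ideal flat_ideal_odd.

Definition tidying_sec (U V : opens X) (h : V `<=` U) :
  struct_sheaf X U -> tidying_sheaf V := quot_section_of flat_ideal_ideal h.

Definition tidying_pi x : stalk (struct_sheaf X) x -> stalk tidying_sheaf x :=
  @stalk_pi _ _ _ flat_ideal_ideal flat_ideal_odd x.

Lemma tidying_piE x (U : opens X) (Ux : opens_set U x) (s : struct_sheaf X U) :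
  tidying_pi (germ Ux s) = germ Ux (tidying_sec (@subset_refl _ U) s).
Proof. exact: stalk_piE. Qed.

Lemma tidying_pi_hom x : ring_hom (@tidying_pi x).
Proof. exact: stalk_pi_hom. Qed.

Lemma tidying_pi_surj x (b : stalk tidying_sheaf x) :
  exists a, b = tidying_pi a.
Proof. exact: stalk_pi_surj. Qed.

Lemma tidying_pi_ker x (a : stalk (struct_sheaf X) x) :
  tidying_pi a = 0 -> flat_ideal x a.
Proof. exact: stalk_pi_ker. Qed.

Lemma tidying_pi_ker_max x (a : stalk (struct_sheaf X) x) :
  tidying_pi a = 0 -> local_ideal (ss_local x) a.
Proof.
by move/tidying_pi_ker; exact: (ideal_infpow_sub (@max_ideal_ideal X x)).
Qed.

Lemma tidying_local x : is_local (stalk tidying_sheaf x).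
Proof.
exact: (image_is_local (@tidying_pi_hom x) (@tidying_pi_surj x)
  (@tidying_pi_ker_max x)).
Qed.

(** The underlying space is that of [X]: flat germs lie in the maximal ideal, so
    no point loses its stalk in the quotient. *)
Definition tidying : superspace := Superspace tidying_local.

Lemma tidying_max_idealE x (a : stalk (struct_sheaf X) x) :
  @max_ideal tidying x (tidying_pi a) <-> max_ideal a.
Proof.
exact: (local_ideal_homE (@tidying_pi_hom x) (@tidying_pi_surj x)
  (@tidying_pi_ker_max x)).
Qed.

(** An element of a power of the image ideal is the image of an element of that
    power, and the two preimages differ by a flat germ. *)
Lemma tidying_ideal_exp x (a : stalk (struct_sheaf X) x) n :
  ideal_exp (@max_ideal tidying x) n (tidying_pi a) ->
  ideal_exp (@max_ideal X x) n a.
Proof.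
have hn := ideal_exp_ideal n (@max_ideal_ideal X x).
move=> /(ideal_exp_image (@tidying_pi_hom x) (@tidying_pi_surj x)
  (@tidying_pi_ker_max x)).
case=> b hb e; apply: (is_ideal_subl hn _ hb).
apply: (@tidying_pi_ker x (a - b) _ n).
by rewrite (ring_homB (@tidying_pi_hom x)) e subrr.
Qed.

Lemma tidying_lift (U : opens X) (s : tidying_sheaf U) x : opens_set U x ->
  exists (W : opens X) (h : W `<=` U) (t : struct_sheaf X W),
    opens_set W x /\ res h s = tidying_sec (@subset_refl _ W) t.
Proof. exact: quot_section_lift. Qed.

(** The quotient map reflects powers of maximal ideals, because its kernel on
    stalks lies in all of them; so if all germs of a section are flat, then so
    are those of its local lifts, whose images are therefore zero. *)
Lemma tidying_tidy : tidy tidying.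
Proof.
move=> x U Ux f flat_f.
have [W [h [w [Wx e]]]] := tidying_lift f Ux.
rewrite -(germ_res h Ux Wx) e.
have -> : tidying_sec (@subset_refl _ W) w = tidying_sec (@subset_refl _ W) 0.
  apply/quot_section_of_eq => y Wy n.
  rewrite (ring_hom0 (germ_hom _ _)) subr0; apply: tidying_ideal_exp.
  have := flat_f y (h y Wy) n; rewrite -(germ_res h (h y Wy) Wy) e.
  by rewrite -tidying_piE (germ_irr _ Wy).
have /superring_morphismP[hq _] :=
  quot_section_of_morph flat_ideal_ideal flat_ideal_odd (@subset_refl _ W).
by rewrite /tidying_sec (ring_hom0 hq) (ring_hom0 (germ_hom _ _)).
Qed.

Lemma tidying_cont : continuous (id : tidying -> X).
Proof. by move=> x; exact: cvg_id. Qed.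

Definition tidying_pullback (V : opens X) :
    struct_sheaf X V -> struct_sheaf tidying (opens_preim tidying_cont V) :=
  @tidying_sec V (opens_preim tidying_cont V) (fun x Vx => Vx).

Lemma tidying_pullback_morph V : superring_morphism (@tidying_pullback V).
Proof. exact: quot_section_of_morph. Qed.

Lemma tidying_pullback_res (V W : opens X) (h : W `<=` V)
  (h' : opens_preim tidying_cont W `<=` opens_preim tidying_cont V) s :
  tidying_pullback (res h s) = res h' (tidying_pullback s).
Proof.
have k : opens_preim tidying_cont W `<=` V by [].
transitivity (tidying_sec k s); first exact: quot_section_res_of.
by apply/esym; exact: quot_section_of_res.
Qed.

Lemma germ_tidying_pullback (x : tidying) (V : opens X)
    (Vx : opens_set V x) (s : struct_sheaf X V) :
  germ (Vx : opens_set (opens_preim tidying_cont V) x) (tidying_pullback s) =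
  tidying_pi (germ Vx s).
Proof.
rewrite tidying_piE.
have h : opens_preim tidying_cont V `<=` V by [].
rewrite -(germ_res h Vx); congr germ.
by apply/esym; exact: quot_section_of_res.
Qed.

Lemma tidying_pullback_local (x : tidying) (V : opens X) (Vx : opens_set V x)
    (s : struct_sheaf X V) :
  max_ideal (germ Vx s) ->
  max_ideal (germ (Vx : opens_set (opens_preim tidying_cont V) x)
               (tidying_pullback s)).
Proof. by rewrite germ_tidying_pullback => /tidying_max_idealE. Qed.

Definition tidying_mor : morphism tidying X :=
  Morphism tidying_pullback_morph tidying_pullback_res tidying_pullback_local.

Lemma tidying_closed_embedding : closed_embedding tidying_mor.
Proof.
split.
  split; [by []|by move=> U; split=> [oU|[V oV ->]//]; exists U|].
  rewrite (_ : range _ = setT); first exact: closedT.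
  by apply/seteqP; split=> // x _; exists x.
move=> V s y Vy; have [W [h [t [Wy e]]]] := tidying_lift s Vy.
exists W, h, t; split=> //.
have h' : opens_preim tidying_cont W `<=` W by [].
transitivity (res h' (res h s)); last exact: res_comp.
by rewrite e; apply/esym; exact: quot_section_of_res.
Qed.

(** * The universal property *)

Section Universal.
Variables (Y : superspace) (phi : morphism Y X).
Hypothesis tidyY : tidy Y.
Notation preim V := (opens_preim (mor_cont phi) V).

(** Pulling back preserves vanishing to infinite order, so sections with the
    same image in the tidying have the same pullback to a tidy space. *)
Lemma tidy_pullback_eq (V : opens X) (s t : struct_sheaf X V) :
  tidying_sec (@subset_refl _ V) s = tidying_sec (@subset_refl _ V) t ->
  pullback phi s = pullback phi t.
Proof.
move=> /quot_section_of_eq e; apply: section_eq => y Vy.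
apply/eqP; rewrite -subr_eq0 -germB -(ring_homB (pullback_hom phi V)).
apply/eqP; apply: tidyY => z Vz n.
apply: (pullback_ideal_exp (f := phi) (Vx := Vz)).
have := e (phi z) Vz n; rewrite !(germ_irr (@subset_refl _ V _ Vz) Vz).
by rewrite germB.
Qed.

(** The local lifts of a section index the covering along which its descent to
    [Y] is glued. *)
Record local_lift (V : opens X) (s : tidying_sheaf V) := LocalLift {
  lift_dom : opens X;
  lift_sub : lift_dom `<=` V;
  lift_sec : struct_sheaf X lift_dom;
  lift_eq : res lift_sub s = tidying_sec (@subset_refl _ lift_dom) lift_sec
}.

Definition is_descent (V : opens X) (s : tidying_sheaf V)
    (r : struct_sheaf Y (preim V)) :=
  forall (i : local_lift s) (y : Y) (Vy : opens_set (preim V) y)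
    (Wy : opens_set (preim (lift_dom i)) y),
    germ Vy r = germ Wy (pullback phi (lift_sec i)).

Lemma lift_at (V : opens X) (s : tidying_sheaf V) x : opens_set V x ->
  exists i : local_lift s, opens_set (lift_dom i) x.
Proof.
move=> Vx; have [W [h [t [Wx e]]]] := tidying_lift s Vx.
by exists (LocalLift e).
Qed.

Lemma tidying_sec_res (U V : opens X) (h : V `<=` U) (s : struct_sheaf X U) :
  tidying_sec (@subset_refl _ V) (res h s) =
  res h (tidying_sec (@subset_refl _ U) s).
Proof.
transitivity (tidying_sec h s); first exact: quot_section_res_of.
by apply/esym; exact: quot_section_of_res.
Qed.

Lemma local_lift_agree (V : opens X) (s : tidying_sheaf V) (i j : local_lift s)
    (y : Y) (yi : opens_set (preim (lift_dom i)) y)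
    (yj : opens_set (preim (lift_dom j)) y) :
  germ yi (pullback phi (lift_sec i)) = germ yj (pullback phi (lift_sec j)).
Proof.
case: i j yi yj => [W h t e] [W' h' t' e'] /= yi yj.
have k : opens_setI W W' `<=` W by move=> x [].
have k' : opens_setI W W' `<=` W' by move=> x [].
have Wy : opens_set (preim (opens_setI W W')) y by split.
rewrite -(germ_pullback_res k t Wy) -(germ_pullback_res k' t' Wy).
congr germ; apply: tidy_pullback_eq.
by rewrite !tidying_sec_res -e -e' !(res_comp _ _ (subset_trans k h)).
Qed.

Lemma descent_exists (V : opens X) (s : tidying_sheaf V) :
  exists r, is_descent s r.
Proof.
have sub (i : local_lift s) : preim (lift_dom i) `<=` preim V.
  by move=> y; exact: lift_sub.
have [||r [hr _]] := @sheafP _ (struct_sheaf Y) (preim V) (local_lift s) _ sub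
  (fun i => pullback phi (lift_sec i)).
- by move=> y Vy; have [i ?] := lift_at s Vy; exists i.
- move=> i j; apply: section_eq => y [yi yj].
  by rewrite !(germ_res _ yi, germ_res _ yj); exact: local_lift_agree.
by exists r => i y Vy Wy; rewrite -hr (germ_res _ Vy).
Qed.

Definition descent (V : opens X) (s : tidying_sheaf V) :=
  sval (cid (descent_exists s)).

Lemma descentP (V : opens X) (s : tidying_sheaf V) : is_descent s (descent s).
Proof. exact: (proj2_sig (cid (descent_exists s))). Qed.

Lemma lift_at2 (V : opens X) (s t : tidying_sheaf V) x : opens_set V x ->
  exists (W : opens X) (h : W `<=` V) (u v : struct_sheaf X W),
    [/\ opens_set W x, res h s = tidying_sec (@subset_refl _ W) u &
        res h t = tidying_sec (@subset_refl _ W) v].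
Proof.
move=> Vx; have [[W h u e] /= Wx] := lift_at s Vx.
have [[W' h' v e'] /= Wx'] := lift_at t Vx.
have k : opens_setI W W' `<=` W by move=> z [].
have k' : opens_setI W W' `<=` W' by move=> z [].
exists (opens_setI W W'), (subset_trans k h), (res k u), (res k' v).
split=> //; rewrite tidying_sec_res -?e -?e'.
  by rewrite (res_comp _ _ (subset_trans k h)).
by rewrite (res_comp _ _ (subset_trans k h)).
Qed.

Lemma tidying_sec_morph (U V : opens X) (h : V `<=` U) :
  superring_morphism (tidying_sec h).
Proof. exact: quot_section_of_morph. Qed.

Lemma descent_morph V : superring_morphism (@descent V).
Proof.
have hq U := (proj1 (superring_morphismP _)
  (tidying_sec_morph (@subset_refl _ (opens_set U)))).1.
have oq U := (proj1 (superring_morphismP _)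
  (tidying_sec_morph (@subset_refl _ (opens_set U)))).2.
apply/superring_morphismP; split; [split; [|split]|].
- move=> s t; apply: section_eq => y Vy.
  have [W [h [u [v [Wy e e']]]]] := lift_at2 s t Vy.
  have est : res h (s - t) = tidying_sec (@subset_refl _ W) (u - v).
    by rewrite (ring_homB (hq W)) (ring_homB (res_hom _ _)) e e'.
  rewrite germB (descentP (i := LocalLift e) Vy Wy)
    (descentP (i := LocalLift e') Vy Wy).
  rewrite (descentP (i := LocalLift est) Vy Wy) /=.
  by rewrite (ring_homB (pullback_hom phi W)) germB.
- apply: section_eq => y Vy.
  have e1 : res (@subset_refl _ V) (1 : tidying_sheaf V) =
      tidying_sec (@subset_refl _ V) 1.
    by rewrite (ring_hom1 (hq V)) (ring_hom1 (res_hom _ _)).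
  by rewrite (descentP (i := LocalLift e1) Vy Vy)
    (ring_hom1 (pullback_hom phi V)).
- move=> s t; apply: section_eq => y Vy.
  have [W [h [u [v [Wy e e']]]]] := lift_at2 s t Vy.
  have est : res h (s * t) = tidying_sec (@subset_refl _ W) (u * v).
    by rewrite (ring_homM (hq W)) (ring_homM (res_hom _ _)) e e'.
  rewrite (ring_homM (germ_hom _ Vy)).
  rewrite (descentP (i := LocalLift e) Vy Wy)
    (descentP (i := LocalLift e') Vy Wy).
  rewrite (descentP (i := LocalLift est) Vy Wy) /=.
  by rewrite (ring_homM (pullback_hom phi W)) 
    (ring_homM (germ_hom _ (Wy : opens_set (preim W) y))).
- move=> s; apply: section_eq => y Vy; have [[W h t e] /= Wy] := lift_at s Vy.
  have eo : res h (odd_part s) = tidying_sec (@subset_refl _ W) (odd_part t).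
    by rewrite oq -e res_odd.
  rewrite -stalk_oddE (descentP (i := LocalLift e) Vy Wy).
  by rewrite (descentP (i := LocalLift eo) Vy Wy) stalk_oddE pullback_odd.
Qed.

Lemma descent_res (V W : opens X) (h : W `<=` V)
  (h' : preim W `<=` preim V) (s : tidying_sheaf V) :
  descent (res h s) = res h' (descent s).
Proof.
apply: section_eq => y Wy; have [[W' k t e] /= Wy'] := lift_at (res h s) Wy.
have e' : res (subset_trans k h) s = tidying_sec (@subset_refl _ W') t.
  by rewrite -e (res_comp _ _ (subset_trans k h)).
rewrite (germ_res h' (h' y Wy)) (descentP (i := LocalLift e) Wy Wy').
by rewrite (descentP (i := LocalLift e') (h' y Wy) Wy').
Qed.

Lemma descent_local (y : Y) (V : opens X) (Vy : opens_set V (phi y))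
    (s : tidying_sheaf V) :
  @max_ideal tidying (phi y) (germ Vy s) ->
  max_ideal (germ (Vy : opens_set (preim V) y) (descent s)).
Proof.
have [[W h t e] /= Wy] := lift_at s Vy.
rewrite -(germ_res h Vy Wy) e -tidying_piE.
move=> /tidying_max_idealE mt; rewrite (descentP (i := LocalLift e) Vy Wy).
exact: pullback_local mt.
Qed.

Definition tidying_factor : morphism Y tidying :=
  @Morphism Y tidying phi (mor_cont phi) descent descent_morph descent_res
    descent_local.

Lemma tidying_factorE : phi = mor_comp tidying_mor tidying_factor.
Proof.
apply: morphism_ext => // V s y Vy Vy'.
have e : res ((fun x Vx => Vx) : V `<=` opens_preim tidying_cont V)
      (tidying_pullback s) =
    tidying_sec (@subset_refl _ V) s by exact: quot_section_of_res.
rewrite (germ_mor_comp s Vy' Vy).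
by rewrite (descentP (i := LocalLift e) Vy Vy).
Qed.

(** Near each point a section of the tidying is the image of a section [t] of
    [X], and the germ of its pullback along [psi] is that of [t] along [phi]. *)
Lemma tidying_factor_uniq (psi : morphism Y tidying) :
  phi = mor_comp tidying_mor psi -> tidying_factor = psi.
Proof.
move=> ephi; have efun y : phi y = psi y by rewrite ephi.
apply: morphism_ext => // V s y Vy Vy'.
have [[W h t e] /= Wy] := lift_at s Vy.
rewrite (descentP (i := LocalLift e) Vy Wy) /=.
have Wy' : opens_set W (psi y) by rewrite -efun.
pose Wc :
  opens_set (opens_preim (mor_cont (mor_comp tidying_mor psi)) W) y := Wy'.
pose Wp : opens_set (opens_preim (mor_cont psi) W) y := Wy'.
rewrite (@germ_pullback_congr _ _ phi _ W t y Wy Wc ephi).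
rewrite (@germ_mor_comp _ _ _ tidying_mor psi W t y Wc Wy').
have k : W `<=` opens_preim tidying_cont W by [].
rewrite -(@germ_pullback_res _ _ psi _ W k (tidying_pullback t) y Wp Wy').
rewrite -(@germ_pullback_res _ _ psi V W h s y Wp Vy') e.
congr (germ _ (pullback psi _)); exact: quot_section_of_res.
Qed.

End Universal.
End Tidying.

Theorem proposition3p47 (X : superspace) :
  exists (Xo : superspace) (t : morphism Xo X),
    closed_embedding t /\ tidy Xo /\
    forall (Y : superspace) (phi : morphism Y X), tidy Y ->
      exists! phio : morphism Y Xo, phi = mor_comp t phio.
Proof.
exists (tidying X), (tidying_mor X).
split; first exact: tidying_closed_embedding.
split=> [|Y phi tidyY]; first exact: tidying_tidy.
exists (tidying_factor phi tidyY); split; first exact: tidying_factorE.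
exact: tidying_factor_uniq.
Qed.
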